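(* Let $\Omega\subset\mathbb{R}^n$ be a bounded domain with smooth boundary containing the origin, let $1<q<2$, $\alpha,t\in\mathbb{R}$, and assume $Q+\alpha-2>0$. Then there exists a constant $C>0$ (depending on $Q,q,\alpha,t,\Omega$ but not on $\phi$) such that for every $\phi\in C_0^\infty(\Omega)$, $$\int_\Omega\rho^{\alpha}|\nabla_\gamma\rho|^t|\nabla_\gamma\phi|^2\,dz\ \ge\ \Big(\frac{Q+\alpha-2}{2}\Big)^2\int_\Omega\rho^{\alpha}\frac{|\nabla_\gamma\rho|^{t+2}}{\rho^2}\phi^2\,dz+C\Big(\int_\Omega|\nabla_\gamma\phi|^q\big(|\nabla_\gamma\rho|^t\rho^{\alpha}\big)^{q/2}\,dz\Big)^{2/q}.$$
   Context: Points of $\mathbb{R}^n$ are written $z=(x,y)$ with $x\in\mathbb{R}^m$, $y\in\mathbb{R}^k$, $m,k\ge1$, $n=m+k$, and $\gamma>0$. The Baouendi–Grushin gradient is $\nabla_\gamma=(\partial_{x_1},\dots,\partial_{x_m},|x|^\gamma\partial_{y_1},\dots,|x|^\gamma\partial_{y_k})$. The homogeneous dimension is $Q=m+(1+\gamma)k$. The gauge is $\rho(z)=\big(|x|^{2(1+\gamma)}+(1+\gamma)^2|y|^2\big)^{\frac{1}{2(1+\gamma)}}$; one has $|\nabla_\gamma\rho|=|x|^\gamma/\rho^\gamma$. The integral on the left-hand side is allowed to be $+\infty$. *)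

(* Defs.v *)
From HB Require Import structures.
From mathcomp Require Import all_boot all_order all_algebra.
From mathcomp Require Import all_classical all_reals all_analysis.
Set Implicit Arguments. Unset Strict Implicit. Unset Printing Implicit Defensive.
Import Order.TTheory GRing.Theory Num.Theory.
Import numFieldNormedType.Exports.
Local Open Scope classical_set_scope.
Local Open Scope ring_scope.

Section Defs.
Variable R : realType.

(* Euclidean norm on R^n (the library norm on 'rV is the max norm). *)
Definition enorm n (x : 'rV[R]_n) : R := Num.sqrt (\sum_(i < n) x 0 i ^+ 2).

Definition edir n (i : 'I_n) : 'rV[R]_n := delta_mx 0 i.

Definition xpart m k (z : 'rV[R]_(m + k)) : 'rV[R]_m := lsubmx z.
Definition ypart m k (z : 'rV[R]_(m + k)) : 'rV[R]_k := rsubmx z.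

Definition grad_gamma m k (g : R) (f : 'rV[R]_(m + k) -> R) (z : 'rV[R]_(m + k))
  : 'rV[R]_(m + k) :=
  \row_(i < m + k)
    ((if (i < m)%N then 1 else enorm (xpart z) `^ g) * derive f z (edir i)).

Definition grad_gamma_norm m k (g : R) (f : 'rV[R]_(m + k) -> R) z : R :=
  enorm (grad_gamma g f z).

Definition homdim m k (g : R) : R := m%:R + (1 + g) * k%:R.

Definition gauge m k (g : R) (z : 'rV[R]_(m + k)) : R :=
  (enorm (xpart z) `^ (2 * (1 + g)) + (1 + g) ^+ 2 * enorm (ypart z) ^+ 2)
    `^ (2 * (1 + g))^-1.

Fixpoint iderive n (l : seq 'rV[R]_n) (f : 'rV[R]_n -> R) : 'rV[R]_n -> R :=
  match l with
  | [::] => f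
  | v :: l' => fun z => derive (iderive l' f) z v
  end.

Definition smooth n (f : 'rV[R]_n -> R) : Prop :=
  forall (l : seq 'rV[R]_n) (z : 'rV[R]_n), differentiable (iderive l f) z.

Definition test_fun n (Om : set 'rV[R]_n) (f : 'rV[R]_n -> R) : Prop :=
  smooth f /\ compact (closure [set z | f z != 0]) /\
  closure [set z | f z != 0] `<=` Om.

(* bounded domain (open, connected, bounded) with smooth boundary:
   near every boundary point Omega is the sublevel set {psi < 0} of a
   smooth defining function psi with nonvanishing gradient *)
Definition smooth_bounded_domain n (Om : set 'rV[R]_n) : Prop :=
  open Om /\ connected Om /\ bounded_set Om /\
  forall p, closure Om p -> ~ Om p ->
    exists (U : set 'rV[R]_n) (psi : 'rV[R]_n -> R),
      [/\ open U, U p, smooth psi,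
          (forall z, U z -> exists v, derive psi z v != 0) &
          Om `&` U = [set z | U z /\ psi z < 0]].

Definition Rn n := g_sigma_algebraType (@open 'rV[R]_n).

(* Lebesgue measure on R^n, characterized on the Borel sets: it is the
   (unique) measure giving every half-open box its volume *)
Definition lebesgue_Rn n (mu : {measure set (Rn n) -> \bar R}) : Prop :=
  forall a b : 'rV[R]_n, (forall i, a 0 i <= b 0 i) ->
    mu [set z : Rn n | forall i, a 0 i <= (z : 'rV[R]_n) 0 i < b 0 i]
    = (\prod_(i < n) (b 0 i - a 0 i))%:E.

End Defs.

(* Main.v *)
(* Write E for the generator of the dilations (x, y) |-> (e^s x, e^((1+g) s) y),
   G for |grad_gamma gauge| = |x|^g / gauge^g, w = gauge^al G^t and
   W = gauge^(al-2) G^(t+2), which is homogeneous of degree al - 2.  By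
   Cauchy-Schwarz w |grad_gamma f|^2 = T + W (E f)^2 with T >= 0.

   On an orbit, integrating d/ds (e^(a s) u^2) for u = f o dil gives
     a u(0)^2 + int_0^oo e^(a s) (u' + a u)^2 ds = int_0^oo e^(a s) u'^2 ds,
   where every term is nonnegative.  Integrating against W dz, Tonelli and the
   scaling of Lebesgue measure give, for s = (Q + al - 2)/2, the identity
     s^2 int W f^2 + int W (E f + s f)^2 = int W (E f)^2   in [0, +oo],
   so the Hardy deficit is int T + int W (E f + s f)^2, whatever the value of t.

   The same computation with u = e^(s .) f o dil and the extra weight gauge^e
   gives int W gauge^e f^2 <= C int W gauge^e (E f + s f)^2.  Hence the deficit
   controls int gauge^e w |grad_gamma f|^2, and Hoelder's inequality with
   int_Om gauge^(-p) < +oo for p < Q yields the L^q term. *)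
Require Import Defs.
From HB Require Import structures.
From mathcomp Require Import all_boot all_order all_algebra.
From mathcomp Require Import all_classical all_reals all_analysis.
From mathcomp Require Import measurable_realfun ring lra.
Import Order.TTheory GRing.Theory Num.Theory.
Import numFieldNormedType.Exports.
Local Open Scope classical_set_scope.
Local Open Scope ring_scope.

(** * Lebesgue measure and dilations *)

(** Working on orbits is what admits every real [t]: for very negative [t] the weights need not be
    locally integrable near x = 0, but [slope] is constant on each orbit, so this singularity never
    meets the one-dimensional computation. All space integrals are of nonnegative functions and no
    two of them are subtracted, so the value +oo is harmless.

    The constant s^2 is the maximum over a of a (2 s - a), the Hardy constant that the orbit
    identity with exponent a yields.

    The extra weight gauge^e is forced: E + s annihilates functions homogeneous of degree -s, for
    which W f^2 has the critical degree -Q, so int W (E f + s f)^2 alone cannot control int W f^2. A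
    factor gauge^e with e > 0 breaks the criticality and is bounded on [Om]; the room left by q < 2
    in Hoelder's inequality pays for it, with p = e (q/2) / (1 - q/2).

    The gradient of the gauge is computed only off {x = 0}. The analysis therefore runs with
    closed-form measurable weights on the whole space, and the integrands of the statement come back
    at the very end. *)

Definition hbox {R : realType} {n} (a b : 'rV[R]_n) : set (Rn R n) :=
  [set z : Rn R n | forall i, a 0 i <= (z : 'rV[R]_n) 0 i < b 0 i].

Definition hboxes (R : realType) n : set (set (Rn R n)) :=
  [set A | exists a b : 'rV[R]_n, (forall i, a 0 i <= b 0 i) /\ A = hbox a b].

Lemma continuous_measurable_Rn (R : realType) n (f : 'rV[R]_n -> R) :
  continuous f -> measurable_fun [set: Rn R n] f.
Proof.
move=> cf; apply: (measurability _ (measurable_realfun.RGenOpens.measurableE R)).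
move=> _ [_ [a [b ->] <-]]; rewrite setTI.
apply: sub_sigma_algebra.
by apply: open_comp => //; exact: interval_open.
Qed.

Lemma measurable_coord (R : realType) n (i : 'I_n) :
  measurable_fun [set: Rn R n] (fun z : Rn R n => (z : 'rV[R]_n) 0 i).
Proof. by apply: continuous_measurable_Rn; exact: coord_continuous. Qed.

Lemma measurable_fun_hbox (R : realType) n d (T : measurableType d)
    (f : T -> 'rV[R]_n) (a b : 'rV[R]_n) :
  (forall i, measurable_fun [set: T] (fun x => f x 0 i)) ->
  measurable (f @^-1` (hbox a b)).
Proof.
move=> mf.
have -> : f @^-1` (hbox a b) =
    \bigcap_(i in [set: 'I_n]) ((fun x => f x 0 i) @^-1` `[a 0 i, b 0 i[%classic).
  apply/seteqP; split=> x /= H; first by move=> i _ /=; rewrite in_itv /=; exact: H.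
  by move=> i; have := H i I; rewrite /= in_itv.
apply: fin_bigcap_measurable => // i _.
by rewrite -[X in measurable X]setTI; exact: mf.
Qed.

(** An open set is the countable union of the half-open boxes with rational corners that it
    contains. This makes the boxes, on which [lebesgue_Rn] prescribes the measure, a generating
    family. *)
Lemma measurable_RnE (R : realType) n :
  (@measurable _ (Rn R n)) = <<s hboxes R n >>.
Proof.
apply/seteqP; split; last first.
  apply: smallest_sub; first exact: sigma_algebra_measurable.
  move=> _ [a [b [_ ->]]]; apply: (@measurable_fun_hbox R n _ (Rn R n) id) => i.
  exact: measurable_coord.
apply: smallest_sub; first exact: smallest_sigma_algebra.
move=> U oU.
pose F (p : 'rV[rat]_n * 'rV[rat]_n) : set (g_sigma_algebraType (hboxes R n)) :=
  let a := map_mx ratr p.1 in let b := map_mx ratr p.2 in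
  if `[< (forall i, a 0 i <= b 0 i) /\ hbox a b `<=` U >] then hbox a b else set0.
have -> : U = \bigcup_p F p.
  apply/seteqP; split=> z.
    move=> Uz; have /nbhs_ballP[e /= e0 zeU] : nbhs z U by exact: open_nbhs_nbhs.
    have H1 i : exists r : rat, ratr r \in `]z 0 i - e, z 0 i[.
      by apply: rat_in_itvoo; rewrite ltrBlDr ltrDl.
    have H2 i : exists r : rat, ratr r \in `]z 0 i, z 0 i + e[.
      by apply: rat_in_itvoo; rewrite ltrDl.
    have /choice[A HA] := H1; have /choice[B HB] := H2.
    exists (\row_i A i, \row_i B i) => //; rewrite /F /=.
    case: asboolP => [_ i|]; last first.
      case; split=> [i|y yb].
        rewrite !mxE; move: (HA i) (HB i); rewrite !in_itv /= => /andP[_ h1] /andP[h2 _].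
        by apply/ltW; exact: lt_trans h2.
      apply: zeU; split=> // i j; rewrite (ord1 i).
      have := yb j; move: (HA j) (HB j); rewrite !in_itv /= !mxE.
      move=> /andP[h1 h2] /andP[h3 h4] /andP[h5 h6].
      by rewrite /ball /= ltr_norml; apply/andP; split; lra.
    move: (HA i) (HB i); rewrite !in_itv /= !mxE => /andP[_ h1] /andP[h2 _].
    by rewrite (ltW h1) h2.
  by case=> p _; rewrite /F; case: asboolP => // -[_]; exact.
apply: (@countable_bigcupT_measurable _ (g_sigma_algebraType (hboxes R n))) => [|p].
  exact: countableP.
rewrite /F; case: asboolP => [[h _]|_]; last exact: measurable0.
by apply: sub_sigma_algebra; exists (map_mx ratr p.1), (map_mx ratr p.2).
Qed.

Lemma measurable_fun_Rn (R : realType) n d (T : measurableType d)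
    (f : T -> Rn R n) :
  (forall i, measurable_fun [set: T] (fun x => (f x : 'rV[R]_n) 0 i)) ->
  measurable_fun [set: T] f.
Proof.
move=> mf; apply: (measurability _ (measurable_RnE R n)).
by move=> _ [_ [a [b [_ ->]]] <-]; rewrite setTI; exact: measurable_fun_hbox.
Qed.

Lemma measurable_hbox (R : realType) n (a b : 'rV[R]_n) :
  measurable (hbox a b).
Proof.
by apply: (@measurable_fun_hbox R n _ (Rn R n) id) => i; exact: measurable_coord.
Qed.

Lemma hboxes_setI (R : realType) n : setI_closed (hboxes R n).
Proof.
move=> _ _ [a [b [ab ->]]] [a' [b' [ab' ->]]].
pose A := \row_i Num.max (a 0 i) (a' 0 i).
(* The outer [max] keeps the corners ordered: disjoint boxes meet in a box of zero width in some
   direction, not in one with reversed corners, about which [lebesgue_Rn] says nothing. *)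
pose B := \row_i Num.max (A 0 i) (Num.min (b 0 i) (b' 0 i)).
exists A, B; split=> [i|]; first by rewrite [B 0 i]mxE le_max lexx.
apply/seteqP; split=> z /=.
  by case=> h h' i; rewrite !mxE ge_max lt_max lt_min;
     move: (h i) (h' i) => /andP[-> ->] /andP[-> ->]; rewrite orbT.
have L i : (b 0 i <= A 0 i) || (b' 0 i <= A 0 i) -> B 0 i = A 0 i.
  by rewrite [B 0 i]mxE => h; apply/max_idPl; rewrite ge_min.
move=> h; have {}h i : [&& a 0 i <= z 0 i, a' 0 i <= z 0 i, z 0 i < b 0 i & z 0 i < b' 0 i].
  have := h i; have [hb|] := boolP ((b 0 i <= A 0 i) || (b' 0 i <= A 0 i)).
    by rewrite (L _ hb) => /andP[h1 h2]; move: (le_lt_trans h1 h2); rewrite ltxx.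
  rewrite [B 0 i]mxE negb_or -!ltNge => /andP[hb hb'].
  rewrite lt_max ltNge => /andP[h1]; rewrite h1 /= lt_min => /andP[-> ->].
  by move: h1; rewrite mxE ge_max => /andP[-> ->].
by split=> i; case/and4P: (h i) => h1 h2 h3 h4; rewrite ?h1 ?h2 ?h3 ?h4.
Qed.

Lemma hbox_bigcup (R : realType) n :
  \bigcup_k hbox (const_mx (- k%:R)) (const_mx k%:R) = [set: Rn R n].
Proof.
apply/seteqP; split=> // z _.
have [k hk] : exists k : nat, forall i, `|(z : 'rV[R]_n) 0 i| < k%:R.
  pose s := \sum_(i < n) `|(z : 'rV[R]_n) 0 i|.
  exists (Num.truncn s).+1 => i; apply: le_lt_trans (truncnS_gt s).
  by rewrite /s (bigD1 i)//= lerDl sumr_ge0.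
exists k => // i; rewrite !mxE; move: (hk i); rewrite ltr_norml => /andP[h1 h2].
by rewrite (ltW h1) h2.
Qed.

Lemma lebesgue_hbox_lty (R : realType) n (mu : {measure set (Rn R n) -> \bar R})
  (a b : 'rV[R]_n) : lebesgue_Rn mu -> (mu (hbox a b) < +oo)%E.
Proof.
move=> Hmu.
have [ab|/existsNP[i /negP]] := pselect (forall i, a 0 i <= b 0 i).
  by rewrite /hbox Hmu// ltry.
rewrite -ltNge => ba.
rewrite (_ : hbox a b = set0) ?measure0//.
apply/seteqP; split=> // z /(_ i) /andP[h1 h2].
by move: (lt_trans (le_lt_trans h1 h2) ba); rewrite ltxx.
Qed.

Lemma lebesgue_sigma_finite (R : realType) n
  (mu : {measure set (Rn R n) -> \bar R}) :
  lebesgue_Rn mu -> sigma_finite [set: Rn R n] mu.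
Proof.
move=> Hmu; exists (fun k => hbox (const_mx (- k%:R)) (const_mx k%:R)).
  by rewrite hbox_bigcup.
by move=> k; split; [exact: measurable_hbox|exact: lebesgue_hbox_lty].
Qed.

Definition dil {R : realType} {n} (c : 'I_n -> R) (s : R) (z : 'rV[R]_n) : 'rV[R]_n :=
  \row_i (expR (c i * s) * z 0 i).

Lemma measurable_dil (R : realType) n (c : 'I_n -> R) s :
  measurable_fun [set: Rn R n] (dil c s : Rn R n -> Rn R n).
Proof.
apply: measurable_fun_Rn => i.
rewrite (_ : (fun _ => _) = (fun z : Rn R n => expR (c i * s) * (z : 'rV[R]_n) 0 i)).
  by apply: measurable_funM => //; exact: measurable_coord.
by apply/funext => z; rewrite mxE.
Qed.

(** Both sides are measures in [A], finite on an exhausting sequence of cubes and equal on boxes,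
    since a diagonal map only rescales the side lengths. Uniqueness on a generating pi-system
    concludes. *)
Lemma lebesgue_dil (R : realType) n (mu : {measure set (Rn R n) -> \bar R})
    (c : 'I_n -> R) (s : R) (A : set (Rn R n)) :
  lebesgue_Rn mu -> measurable A ->
  mu ((dil c s : Rn R n -> Rn R n) @^-1` A)
  = ((expR (- (\sum_i c i) * s))%:E * mu A)%E.
Proof.
move=> Hmu mA.
have mD := measurable_dil R n c s.
pose r := NngNum (expR_ge0 (- (\sum_i c i) * s)).
rewrite -[LHS]/(pushforward mu (dil c s : Rn R n -> Rn R n) A).
rewrite -[RHS]/(mscale r mu A).
apply: (@measure_unique _ R (Rn R n) (hboxes R n)
  (fun k => hbox (const_mx (- k%:R)) (const_mx k%:R))) => //.
- exact: measurable_RnE.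
- exact: hboxes_setI.
- move=> k; exists (const_mx (- k%:R)), (const_mx k%:R); split=> // i.
  by rewrite !mxE ge0_cp.
- exact: hbox_bigcup.
- move=> _ [a [b [ab ->]]].
  rewrite /mscale/= /pushforward.
  rewrite [X in mu X](_ : _ = hbox (dil c (- s) a) (dil c (- s) b)).
    rewrite /hbox !Hmu//; last first.
      by move=> i; rewrite !mxE ler_pM2l// expR_gt0.
    rewrite -[RHS]/((expR (- (\sum_i c i) * s))%:E * mu (hbox a b))%E /hbox Hmu// -EFinM; congr EFin.
    rewrite mulNr -mulrN mulr_suml expR_sum -big_split /=.
    by apply: eq_bigr => i _; rewrite !mxE -mulrBr.
  apply/seteqP; split=> z /= H i; move: (H i); rewrite !mxE mulrN expRN;
    by rewrite ler_pdivrMl ?expR_gt0// ltr_pdivlMl ?expR_gt0.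
- move=> k.
  rewrite -[X in (X < _)%E]/(mu (dil c s @^-1` hbox (const_mx (- k%:R)) (const_mx k%:R))).
  rewrite [X in mu X](_ : _ = hbox (dil c (- s) (const_mx (- k%:R))) (dil c (- s) (const_mx k%:R))).
    exact: lebesgue_hbox_lty.
  apply/seteqP; split=> z /= H i; move: (H i); rewrite !mxE [c i * - s]mulrN expRN;
    by rewrite ler_pdivrMl ?expR_gt0// ltr_pdivlMl ?expR_gt0.
Qed.

Lemma integral_dil (R : realType) n (mu : {measure set (Rn R n) -> \bar R})
    (c : 'I_n -> R) (s : R) (F : Rn R n -> \bar R) :
  lebesgue_Rn mu -> measurable_fun [set: Rn R n] F -> (forall z, 0 <= F z)%E ->
  (\int[mu]_z F (dil c s z) = (expR (- (\sum_i c i) * s))%:E * \int[mu]_z F z)%E.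
Proof.
move=> Hmu mF F0.
have mD := measurable_dil R n c s.
pose r := NngNum (expR_ge0 (- (\sum_i c i) * s)).
rewrite -[RHS]/(r%:num%:E * \int[mu]_z F z)%E.
rewrite -[RHS](ge0_integral_mscale mu measurableT r mF)//.
transitivity (\int[pushforward mu (dil c s : Rn R n -> Rn R n)]_z F z)%E.
  by rewrite (ge0_integral_pushforward mD mu measurableT mF)// preimage_setT.
apply: (eq_measure_integral (mscale r mu)) => A mA _.
by have := @lebesgue_dil R n mu c s A Hmu mA.
Qed.

(* A bounded slab of {z_i = 0} is fixed by the dilation along the i-th axis, which doubles the measure. *)
Lemma lebesgue_hyperplane (R : realType) n (mu : {measure set (Rn R n) -> \bar R})
    (i : 'I_n) :
  lebesgue_Rn mu -> mu [set z : Rn R n | (z : 'rV[R]_n) 0 i = 0] = 0%E.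
Proof.
move=> Hmu; set H := [set _ | _].
have mH : measurable H.
  rewrite (_ : H = (fun z : Rn R n => (z : 'rV[R]_n) 0 i) @^-1` [set 0])//.
  by rewrite -[X in measurable X]setTI; exact: measurable_coord.
pose K k := hbox (const_mx (- k%:R)) (const_mx k%:R) : set (Rn R n).
apply/eqP; rewrite -measure_le0.
apply: (@le_trans _ _ (mu (\bigcup_k (H `&` K k)))).
  by rewrite -setI_bigcupr hbox_bigcup setIT.
apply: (le_trans (measure_sigma_subadditive _ _ _ (@subset_refl _ _))) => //.
- by move=> k; apply: measurableI => //; exact: measurable_hbox.
- apply: bigcupT_measurable => k; apply: measurableI => //; exact: measurable_hbox.
rewrite eseries0// => k _ _.
pose c (j : 'I_n) : R := (j == i)%:R.
have /= := @lebesgue_dil R n mu c (- ln 2) (H `&` K k) Hmu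
  (measurableI _ _ mH (measurable_hbox _ _ _ _)).
rewrite [X in mu X](_ : _ = H `&` K k); last first.
  have E (z : 'rV[R]_n) : z 0 i = 0 -> dil c (- ln 2) z = z.
    move=> zi; apply/rowP => j; rewrite mxE /c.
    by have [->|_] := eqVneq j i; rewrite ?zi ?mulr0// mul0r expR0 mul1r.
  have E0 (z : 'rV[R]_n) : dil c (- ln 2) z 0 i = 0 -> z 0 i = 0.
    by rewrite mxE => /eqP; rewrite mulf_eq0 gt_eqF ?expR_gt0//= => /eqP.
  apply/seteqP; split=> z /= -[h1 h2].
    by have := E z (E0 _ h1) => e; rewrite e in h1 h2.
  by rewrite E.
rewrite (_ : \sum_j c j = 1); last first.
  by rewrite (bigD1 i)//= /c eqxx big1 ?addr0// => j /negbTE ->.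
rewrite mulrNN mul1r lnK ?posrE//.
have : (mu (H `&` K k) < +oo)%E.
  apply: le_lt_trans (@lebesgue_hbox_lty R n mu (const_mx (- k%:R)) (const_mx k%:R) Hmu).
  by apply: le_measure; rewrite ?inE//; [apply: measurableI => //|]; exact: measurable_hbox.
have : (0 <= mu (H `&` K k))%E by [].
case: (mu _) => // r _ _ [] /eqP; rewrite -subr_eq0 mulr2n mulrDl mul1r opprD addrA subrr sub0r oppr_eq0.
by move=> /eqP ->.
Qed.

(* [f] need not be measurable: the integral of a nonnegative function is a supremum over the simple functions below it. *)
Lemma ge0_integral_off_null {d} {T : measurableType d} {R : realType}
    (mu : {measure set T -> \bar R}) (N D : set T) (f f' : T -> \bar R) :
  measurable N -> mu N = 0%E -> measurable D ->
  measurable_fun [set: T] f' -> (forall x, 0 <= f x)%E -> (forall x, 0 <= f' x)%E ->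
  (forall x, ~ N x -> f x = f' x) ->
  (\int[mu]_(x in D) f x = \int[mu]_(x in D) f' x)%E.
Proof.
move=> mN N0 mD mf' f0 f'0 ff'.
rewrite integral_mkcond [RHS]integral_mkcond.
have mg : measurable_fun [set: T] (f' \_ D).
  by apply/measurable_restrict => //; exact: measurable_funTS.
have {}ff' x : ~ N x -> (f \_ D) x = (f' \_ D) x.
  by move=> Nx; rewrite !patchE; case: ifP => // _; exact: ff'.
have {}f0 x : (0 <= (f \_ D) x)%E by rewrite patchE; case: ifP.
have {}f'0 x : (0 <= (f' \_ D) x)%E by rewrite patchE; case: ifP.
set F := f \_ D in ff' f0 *; set F' := f' \_ D in ff' f'0 mg *.
(* On [N], [lo] is 0 and [hi] is +oo; both are measurable with the same integral as [F']. A simple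
   function below [F] is below [hi], and one below [lo] is below [F], which traps the integral of
   [F]. *)
pose lo := F' \_ (~` N); pose hi := (F' \+ (cst +oo%E \_ N))%E.
have mlo : measurable_fun [set: T] lo.
  by apply/measurable_restrict => //; [exact: measurableC|exact: measurable_funTS].
have mhi : measurable_fun [set: T] hi.
  apply: emeasurable_funD => //.
  by apply/measurable_restrict => //; exact: measurable_cst.
have lo0 x : (0 <= lo x)%E by rewrite /lo patchE; case: ifP.
have hi0 x : (0 <= hi x)%E.
  by apply: adde_ge0 => //; rewrite patchE; case: ifP => _ //=; rewrite leey.
have ae g : (forall x, ~ N x -> g x = F' x) -> ae_eq mu [set: T] g F'.
  move=> H; exists N; split=> // x /=.
  by apply: contra_notP => Nx _; exact: H.
have Elo : (\int[mu]_x lo x = \int[mu]_x F' x)%E.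
  apply: ge0_ae_eq_integral => //; apply: ae => x Nx.
  by rewrite /lo patchE ifT// inE.
have Ehi : (\int[mu]_x hi x = \int[mu]_x F' x)%E.
  apply: ge0_ae_eq_integral => //; apply: ae => x Nx.
  by rewrite /hi /= [X in (_ + X)%E]patchE ifF ?adde0//; apply/negbTE; rewrite notin_setE.
apply/eqP; rewrite eq_le -{1}Ehi -Elo !ge0_integralTE//.
apply/andP; split; apply: le_ereal_sup => _ [h /= hh <-]; exists h => //= x;
  apply: (le_trans (hh x)).
- rewrite /hi /= [X in (_ + X)%E]patchE; case: ifPn => [/set_mem Nx|]; first by rewrite addey ?leey// gt_eqF// (lt_le_trans _ (f'0 x)).
  by rewrite notin_setE => Nx; rewrite adde0 ff'.
- rewrite /lo patchE; case: ifPn => [/set_mem Nx|]; first by rewrite ff'.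
  by move=> _; exact: f0.
Qed.

(** * The one-dimensional identity on a half-line *)

Lemma integral_expRN {R : realType} (k : R) : 0 < k ->
  (\int[lebesgue_measure]_(s in `[0%R, +oo[) (expR (- k * s))%:E = (k^-1)%:E)%E.
Proof.
move=> k0; have := integral_exponential_pdf k0.
rewrite (_ : (fun x => _) = (fun s => (k * expR (- k * s))%:E) \_ `[0, +oo[); last first.
  by apply/funext => s; rewrite /exponential_pdf !patchE; case: ifP.
rewrite -integral_mkcond.
under eq_integral do rewrite EFinM.
rewrite ge0_integralZl_EFin ?ltW//; last first.
  by apply/measurable_EFinP/measurable_funTS/measurableT_comp => //; exact: measurable_funM.
move=> /(congr1 (fun x => (k^-1)%:E * x)%E).
by rewrite muleA -EFinM mulVf ?gt_eqF// mul1e mule1.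
Qed.

Lemma is_derive_expRM {R : realType} (a s : R) :
  is_derive s 1 (fun u : R => expR (a * u)) (expR (a * s) * a).
Proof.
apply: is_derive1_comp; apply: is_derive_eq.
by rewrite /GRing.scale /= mulr1.
Qed.

Lemma continuous_is_derive {R : realType} (U V : R -> R) :
  (forall s : R, is_derive s 1 U (V s)) -> continuous U.
Proof.
by move=> dU s; apply: differentiable_continuous; apply/derivable1_diffP; exact: ex_derive.
Qed.

(* The derivative of [- a e^(a s) U^2] is [e^(a s) U'^2 - e^(a s) (U' + a U)^2]. *)
Lemma weighted_square_identity {R : realType} (U V : R -> R) (a M : R) :
  0 < M -> (forall s : R, is_derive s 1 U (V s)) -> continuous V ->
  (forall s, M <= s -> U s = 0) -> (forall s, M <= s -> V s = 0) ->
  ((a * U 0 ^+ 2)%:E +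
   \int[lebesgue_measure]_(s in `[0%R, +oo[) (expR (a * s) * (V s + a * U s) ^+ 2)%:E
   = \int[lebesgue_measure]_(s in `[0%R, +oo[) (expR (a * s) * V s ^+ 2)%:E)%E.
Proof.
move=> M0 dU cV UM VM.
have cU := continuous_is_derive _ _ dU.
have cE : continuous (fun s : R => expR (a * s)).
  exact: continuous_is_derive (is_derive_expRM a).
(* Beyond [M] the integrands vanish, so the half-line shrinks to a segment, where continuity gives
   finite integrals and the fundamental theorem of calculus has no boundary term at [M]. *)
have trunc (f : R -> R) : (forall s, M <= s -> f s = 0) ->
    (\int[lebesgue_measure]_(s in `[0%R, +oo[) (f s)%:E =
     \int[lebesgue_measure]_(s in `[0%R, M]) (f s)%:E)%E.
  move=> fM; have -> : (`[0%R, M]%classic : set R) = `[0%R, +oo[ `&` `[0%R, M].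
    apply/seteqP; split=> s /=; rewrite !in_itv /= ?andbT; last by case.
    by move=> /andP[-> ->].
  rewrite integral_mkcondr; apply: eq_integral => s; rewrite inE /= in_itv /= andbT => s0.
  rewrite patchE; case: ifPn => //; rewrite notin_setE /= in_itv /= s0 /= => /negP.
  by rewrite -ltNge => /ltW/fM ->.
pose p s := expR (a * s) * V s ^+ 2; pose r s := expR (a * s) * (V s + a * U s) ^+ 2.
have cp : continuous p.
  move=> s; apply: (@continuousM _ _ (fun s => expR (a * s)) (fun s => V s ^+ 2)); first exact: cE.
  exact: (@continuous_comp _ _ _ V (fun x => x ^+ 2) s (cV s) (@exprn_continuous _ 2 _)).
have cr : continuous r.
  move=> s; apply: (@continuousM _ _ (fun s => expR (a * s)) (fun s => (V s + a * U s) ^+ 2)); first exact: cE.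
  have cs : {for s, continuous (fun s => V s + a * U s)}.
    apply: continuousD; first exact: cV.
    by apply: continuousM; [exact: cst_continuous|exact: cU].
  exact: (@continuous_comp _ _ _ (fun s => V s + a * U s) (fun x => x ^+ 2) s cs (@exprn_continuous _ 2 _)).
rewrite !trunc; [|by move=> s Ms; rewrite VM// expr0n mulr0|by move=> s Ms; rewrite VM// UM// mulr0 addr0 expr0n mulr0].
have ic (f : R -> R) : continuous f -> lebesgue_measure.-integrable `[0%R, M] (EFin \o f).
  move=> cf; apply: continuous_compact_integrable; first exact: segment_compact.
  exact: continuous_subspaceT.
pose F (s : R) : R := - a * (expR (a * s) * U s ^+ 2).
have dF (s : R) : is_derive s 1 F (p s - r s).
  have dE := is_derive_expRM a s.
  have d2 : is_derive s 1 (U * U) (2 * U s * V s).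
    by apply: is_derive_eq; rewrite /GRing.scale /=; ring.
  have d3 : is_derive s 1 ((fun s : R => expR (a * s)) * (U * U)) (expR (a * s) * (2 * U s * V s) + a * expR (a * s) * U s ^+ 2).
    apply: is_derive_eq; rewrite /GRing.scale /=.
    by rewrite -[(U * U) s]/(U s * U s); ring.
  have d4 : is_derive s 1 (- a *: ((fun s : R => expR (a * s)) * (U * U))) (- a * (expR (a * s) * (2 * U s * V s) + a * expR (a * s) * U s ^+ 2)).
    exact: is_deriveZ.
  by rewrite (_ : F = - a *: ((fun s : R => expR (a * s)) * (U * U)))//; apply: is_derive_eq; rewrite /p /r; ring.
have cF := continuous_is_derive _ _ dF.
have := @continuous_FTC2 R (fun s => p s - r s) F 0 M M0.
have -> : F M = 0 by rewrite /F UM// expr0n /= !mulr0.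
have -> : F 0 = - (a * U 0 ^+ 2) by rewrite /F mulr0 expR0 mul1r mulNr.
move=> /(_ _ _ _)/wrap[].
- by apply: continuous_subspaceT => s; apply: continuousB; [exact: cp|exact: cr].
- split; first by move=> s _; exact: ex_derive.
  + exact/cvg_at_right_filter/cF.
  + exact/cvg_at_left_filter/cF.
- by move=> s _; rewrite derive1E; exact: derive_val.
under eq_integral do rewrite EFinB.
rewrite integralB_EFin//; [|exact: ic|exact: ic].
have fr : (\int[lebesgue_measure]_(x in `[0%R, M]) (r x)%:E \is a fin_num)%E.
  exact: integrable_fin_num (ic _ cr).
have fp : (\int[lebesgue_measure]_(x in `[0%R, M]) (p x)%:E \is a fin_num)%E.
  exact: integrable_fin_num (ic _ cp).
rewrite -/(r _) -/(p _); rewrite -EFinB sub0r opprK => /eqP.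
by rewrite sube_eq ?fin_num_adde_defl// => /eqP ->.
Qed.

(** * Integration over orbits: Tonelli and dilations *)

Lemma measurable_orbit {R : realType} {n} (c : 'I_n -> R) d (T : measurableType d)
    (f : T -> Rn R n) (h : T -> R) :
  measurable_fun [set: T] f -> measurable_fun [set: T] h ->
  measurable_fun [set: T] (fun p => dil c (h p) (f p) : Rn R n).
Proof.
move=> mf mh; apply: measurable_fun_Rn => i.
rewrite (_ : (fun _ => _) = (fun p => expR (c i * h p) * (f p : 'rV[R]_n) 0 i)).
  apply: measurable_funM.
    by apply: measurableT_comp => //; exact: measurable_funM.
  exact: measurableT_comp (measurable_coord _ _ i) mf.
by apply/funext => p; rewrite mxE.
Qed.

(** An alias of [mu] that keeps the proof [Hmu] as an argument, so that the sigma-finite structure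
    required by Tonelli can be attached to it. *)
Definition sigma_finite_copy {d} {T : measurableType d} {R : realType}
  (mu : {measure set T -> \bar R}) (Hmu : sigma_finite [set: T] mu) : set T -> \bar R := mu.

HB.instance Definition _ d (T : measurableType d) (R : realType)
  (mu : {measure set T -> \bar R}) (Hmu : sigma_finite [set: T] mu) :=
  Measure.copy (sigma_finite_copy mu Hmu) mu.

HB.instance Definition _ d (T : measurableType d) (R : realType)
  (mu : {measure set T -> \bar R}) (Hmu : sigma_finite [set: T] mu) :=
  Measure_isSigmaFinite.Build _ _ _ (sigma_finite_copy mu Hmu) Hmu.

(** For fixed s, write W(z) = e^(-w s) W(dil s z) and change variables: the integral over z is e^((a
    - w - sum c) s) times int W F. A decaying exponential on the half-line remains, whence the
    constant. *)
Lemma tonelli_dil {R : realType} {n} (mu : {measure set (Rn R n) -> \bar R})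
    (c : 'I_n -> R) (W F : Rn R n -> R) (w a : R) :
  lebesgue_Rn mu -> measurable_fun [set: Rn R n] W -> measurable_fun [set: Rn R n] F ->
  (forall z, 0 <= W z) -> (forall z, 0 <= F z) ->
  (forall s z, W (dil c s z) = expR (w * s) * W z) ->
  0 < \sum_i c i + w - a ->
  (\int[mu]_z ((W z)%:E * \int[lebesgue_measure]_(s in `[0%R, +oo[) (expR (a * s) * F (dil c s z))%:E)
   = ((\sum_i c i + w - a)^-1)%:E * \int[mu]_z (W z * F z)%:E)%E.
Proof.
move=> Hmu mW mF W0 F0 HW Ha.
pose smu := sigma_finite_copy mu (lebesgue_sigma_finite _ _ _ Hmu).
(* The exponent a - w absorbs the homogeneity of [W], so that [z] enters [f] below only through
   [dil c s z]. *)
pose e s : R := (expR ((a - w) * s)) * \1_(`[0, +oo[%classic : set R) s.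
have me : measurable_fun [set: R] e.
  apply: measurable_funM; last exact: measurable_indic.
  by apply: measurableT_comp => //; exact: measurable_funM.
have e0 s : 0 <= e s by rewrite /e mulr_ge0 ?expR_ge0.
have mD : measurable_fun [set: Rn R n * measurableTypeR R] (fun p => dil c p.2 p.1 : Rn R n).
  by apply: measurable_orbit; [exact: measurable_fst|exact: measurable_snd].
pose f (p : Rn R n * measurableTypeR R) : \bar R := (e p.2 * (W (dil c p.2 p.1) * F (dil c p.2 p.1)))%:E.
have mf : measurable_fun [set: Rn R n * measurableTypeR R] f.
  apply/measurable_EFinP; apply: measurable_funM.
    by apply: measurableT_comp => //; exact: measurable_snd.
  apply: measurable_funM; [exact: measurableT_comp mW mD|exact: measurableT_comp mF mD].
have f0 p : (0 <= f p)%E by rewrite lee_fin !mulr_ge0.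
have fub := @fubini_tonelli _ _ (Rn R n) (measurableTypeR R) R smu lebesgue_measure f mf f0.
transitivity (\int[mu]_z \int[lebesgue_measure]_s f (z, s))%E.
  apply: eq_integral => z _.
  rewrite integral_mkcond -ge0_integralZl_EFin//; last 2 first.
  - by move=> s _; rewrite patchE; case: ifP => // _; rewrite lee_fin mulr_ge0 ?expR_ge0.
  - apply/measurable_restrict => //; apply: measurable_funTS.
    apply/measurable_EFinP/measurable_funM.
      by apply: measurableT_comp => //; exact: measurable_funM.
    exact: measurableT_comp mF (@measurable_orbit R n c _ (measurableTypeR R)
      (fun=> z) (fun s => s) (measurable_cst _) (@measurable_id _ _ _)).
  apply: eq_integral => s _; rewrite /f /e /= HW patchE indicE; case: ifP => _ /=.
    rewrite -EFinM mulr1 mulrBl expRD expRN; congr EFin.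
    by field; rewrite gt_eqF ?expR_gt0.
  by rewrite mule0 mulr0 mul0r.
rewrite -[LHS]/(\int[smu]_z \int[lebesgue_measure]_s f (z, s))%E fub.
transitivity (\int[lebesgue_measure]_(s in `[0%R, +oo[)
    ((expR (- (\sum_i c i + w - a) * s))%:E * \int[mu]_z (W z * F z)%:E))%E.
  rewrite [RHS]integral_mkcond; apply: eq_integral => s _.
  rewrite /f /=; under eq_integral do rewrite EFinM.
  rewrite ge0_integralZl_EFin//; last 2 first.
  - by move=> z _; rewrite lee_fin mulr_ge0.
  - apply/measurable_EFinP/measurable_funM.
      exact: measurableT_comp mW (measurable_dil _ _ _ _).
    exact: measurableT_comp mF (measurable_dil _ _ _ _).
  rewrite (@integral_dil R n mu c s (fun z => (W z * F z)%:E))//; last 2 first.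
  - by apply/measurable_EFinP/measurable_funM.
  - by move=> z; rewrite lee_fin mulr_ge0.
  rewrite patchE /e indicE; case: ifP => _ /=; last by rewrite mulr0 mul0e.
  rewrite mulr1 muleA -EFinM -expRD; congr ((expR _)%:E * _)%E; ring.
rewrite ge0_integralZr// ?integral_expRN//.
- apply/measurable_funTS/measurable_EFinP/measurableT_comp => //; exact: measurable_funM.
- by apply: integral_ge0 => z _; rewrite lee_fin mulr_ge0.
Qed.

(** Adding integrals over z of such orbit integrals requires their measurability in z; it is the
    measurability part of Tonelli. *)
Lemma measurable_orbit_integral {R : realType} {n} (c : 'I_n -> R) (F : Rn R n -> R) (a : R) :
  measurable_fun [set: Rn R n] F -> (forall z, 0 <= F z) ->
  measurable_fun [set: Rn R n] (fun z =>
    \int[lebesgue_measure]_(s in `[0%R, +oo[) (expR (a * s) * F (dil c s z))%:E)%E.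
Proof.
move=> mF F0.
pose f (p : Rn R n * measurableTypeR R) : \bar R :=
  (expR (a * p.2) * \1_(`[0, +oo[%classic : set R) p.2 * F (dil c p.2 p.1))%:E.
have mf : measurable_fun [set: Rn R n * measurableTypeR R] f.
  apply/measurable_EFinP; apply: measurable_funM.
    apply: measurable_funM.
      apply: measurableT_comp => //; apply: measurable_funM => //; exact: measurable_snd.
    by apply: measurableT_comp => //; exact: measurable_snd.
  apply: measurableT_comp mF _.
  by apply: measurable_orbit; [exact: measurable_fst|exact: measurable_snd].
have f0 p : (0 <= f p)%E by rewrite lee_fin !mulr_ge0 ?expR_ge0.
have := @measurable_fun_fubini_tonelli_F _ _ (Rn R n) (measurableTypeR R) R lebesgue_measure f mf f0.
congr (measurable_fun _ _); apply/funext => z; rewrite [RHS]integral_mkcond.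
apply: eq_integral => s _; rewrite /f /= patchE indicE; case: ifP => _ /=.
  by rewrite mulr1.
by rewrite mulr0 mul0r.
Qed.

(** * Derivatives along orbits and the gradient of the gauge *)

Lemma is_derive_comp_path {R : realType} {n} (f : 'rV[R]_n -> R) (p : R -> 'rV[R]_n)
    (dp : 'I_n -> R) (s : R) :
  differentiable f (p s) -> (forall i, is_derive s 1 (fun u => p u 0 i) (dp i)) ->
  is_derive s 1 (f \o p) (\sum_i dp i * 'D_(edir R i) f (p s)).
Proof.
move=> df dpi.
have pd : derivable p s 1.
  by apply/derivable_mxP => i j; rewrite (ord1 i); exact: ex_derive.
have pdf : differentiable p s by exact/derivable1_diffP.
apply: DeriveDef; first by apply/derivable1_diffP; exact: differentiable_comp.
rewrite deriveE; last exact: differentiable_comp.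
rewrite diff_comp//= -(deriveE _ pdf) derive_mx//.
rewrite [X in 'd f (p s) X]row_sum_delta linear_sum /=.
apply: eq_bigr => i _.
by rewrite linearZ /= mxE (derive_val (is_derive := dpi i)) -(deriveE _ df).
Qed.

Lemma is_derive_comp_real {R : realType} {V : normedModType R} (N : V -> R) (f : R -> R)
    (z v : V) (dN df : R) :
  differentiable N z -> is_derive z v N dN -> is_derive (N z) 1 f df ->
  is_derive z v (f \o N) (df * dN).
Proof.
move=> dfN dN' df'.
have dff : differentiable f (N z) by apply/derivable1_diffP; exact: ex_derive.
apply: DeriveDef; first by apply: diff_derivable; exact: differentiable_comp.
rewrite deriveE; last exact: differentiable_comp.
rewrite diff_comp//= -(deriveE _ dfN) (derive_val (is_derive := dN')).
rewrite -[X in 'd f (N z) X]mulr1 -[X in 'd f (N z) X]/(dN *: 1) linearZ /=.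
by rewrite -(deriveE _ dff) (derive_val (is_derive := df')) mulrC.
Qed.

Definition euler {R : realType} {n} (c : 'I_n -> R) (f : 'rV[R]_n -> R) (z : 'rV[R]_n) : R :=
  \sum_i c i * z 0 i * 'D_(edir R i) f z.

Lemma is_derive_dil {R : realType} {n} (c : 'I_n -> R) (f : 'rV[R]_n -> R)
    (z : 'rV[R]_n) (s : R) :
  differentiable f (dil c s z) ->
  is_derive s 1 (fun u => f (dil c u z)) (euler c f (dil c s z)).
Proof.
move=> df.
have dE i : is_derive s 1 (fun u => dil c u z 0 i) (c i * dil c s z 0 i).
  rewrite (_ : (fun _ => _) = z 0 i *: (fun u : R => expR (c i * u))); last first.
    by apply/funext => u; rewrite mxE mulrC.
  have d1 := is_derive_expRM (c i) s.
  by apply: is_derive_eq; rewrite mxE /GRing.scale /=; ring.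
have := @is_derive_comp_path R n f (fun u => dil c u z) _ s df dE.
by [].
Qed.

Lemma is_derive_coord {R : realType} {n} (i j : 'I_n) (z : 'rV[R]_n) :
  is_derive z (edir R j) (fun y : 'rV[R]_n => y 0 i) (i == j)%:R.
Proof.
have dc : differentiable (fun y : 'rV[R]_n => y 0 i) z by exact: differentiable_coord.
apply: DeriveDef; first exact: diff_derivable.
have := @derive_mx R 'rV[R]_n 1 n id z (edir R j) (@ex_derive _ _ _ _ _ _ _ (is_derive_id z _)).
by rewrite derive_id => /matrixP/(_ 0 i); rewrite !mxE /= eq_sym => <-.
Qed.

Definition sqx {R : realType} {m k} (z : 'rV[R]_(m + k)) : R :=
  \sum_(i < m) z 0 (lshift k i) ^+ 2.
Definition sqy {R : realType} {m k} (z : 'rV[R]_(m + k)) : R :=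
  \sum_(j < k) z 0 (rshift m j) ^+ 2.

Lemma enormX {R : realType} {n} (x : 'rV[R]_n) :
  enorm x = (\sum_(i < n) x 0 i ^+ 2) `^ 2^-1.
Proof. by rewrite /enorm powR12_sqrt// sumr_ge0// => i _; exact: sqr_ge0. Qed.

Lemma enorm_xpart {R : realType} {m k} (z : 'rV[R]_(m + k)) :
  enorm (xpart z) = sqx z `^ 2^-1.
Proof. by rewrite enormX; congr (_ `^ _); apply: eq_bigr => i _; rewrite mxE. Qed.

Lemma sqx_ge0 {R : realType} {m k} (z : 'rV[R]_(m + k)) : 0 <= sqx z.
Proof. by rewrite sumr_ge0// => i _; exact: sqr_ge0. Qed.

Lemma sqy_ge0 {R : realType} {m k} (z : 'rV[R]_(m + k)) : 0 <= sqy z.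
Proof. by rewrite sumr_ge0// => i _; exact: sqr_ge0. Qed.

(** This is gauge^(2 (1 + g)), the base of the power that defines the gauge. Written in [sqx], it
    involves only a real power of a polynomial that is positive off {x = 0}. *)
Definition gaugeS {R : realType} {m k} (g : R) (z : 'rV[R]_(m + k)) : R :=
  sqx z `^ (1 + g) + (1 + g) ^+ 2 * sqy z.

Lemma gaugeS_ge0 {R : realType} {m k} (g : R) (z : 'rV[R]_(m + k)) : 0 <= gaugeS g z.
Proof. by rewrite addr_ge0 ?powR_ge0// mulr_ge0 ?sqr_ge0 ?sqy_ge0. Qed.

Lemma gaugeE {R : realType} {m k} (g : R) (z : 'rV[R]_(m + k)) :
  gauge g z = gaugeS g z `^ (2 * (1 + g))^-1.
Proof.
rewrite /gauge enorm_xpart -powRrM mulrA mulVf ?pnatr_eq0// mul1r.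
rewrite /enorm sqr_sqrtr; last by rewrite sumr_ge0// => i _; exact: sqr_ge0.
by congr ((_ + _ * _) `^ _); apply: eq_bigr => i _; rewrite mxE.
Qed.

Lemma differentiable_sumsq {R : realType} {n p} (h : 'I_p -> 'I_n) (z : 'rV[R]_n) :
  differentiable (fun y : 'rV[R]_n => \sum_(i < p) y 0 (h i) ^+ 2) z.
Proof.
rewrite (_ : (fun _ => _) = \sum_(i < p) (fun y : 'rV[R]_n => y 0 (h i)) ^+ 2); last first.
  by apply/funext => y; rewrite fct_sumE.
by apply: differentiable_sum => i; apply: differentiableX; exact: differentiable_coord.
Qed.

Lemma is_derive_sumsq {R : realType} {n p} (h : 'I_p -> 'I_n) (z : 'rV[R]_n) (j : 'I_n) :
  is_derive z (edir R j) (fun y : 'rV[R]_n => \sum_(i < p) y 0 (h i) ^+ 2)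
    (\sum_(i < p) (h i == j)%:R * (2 * z 0 (h i))).
Proof.
rewrite (_ : (fun y : 'rV[R]_n => _) =
    \sum_(i < p) ((fun y : 'rV[R]_n => y 0 (h i)) * (fun y : 'rV[R]_n => y 0 (h i)))); last first.
  by apply/funext => y; rewrite fct_sumE.
apply: is_derive_sum => i.
have d := is_derive_coord (h i) j z.
by apply: is_derive_eq; rewrite /GRing.scale /=; ring.
Qed.

Lemma sumr_delta {R : realType} {p} {I : eqType} (h : 'I_p -> I) (i : 'I_p) (F : 'I_p -> R) :
  injective h -> \sum_(l < p) (h l == h i)%:R * F l = F i.
Proof.
move=> hI; rewrite (bigD1 i)//= eqxx mul1r big1 ?addr0// => l li.
by rewrite (inj_eq hI) (negbTE li) mul0r.
Qed.

Definition dilexp {R : realType} (m k : nat) (g : R) (i : 'I_(m + k)) : R :=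
  if (i < m)%N then 1 else 1 + g.

Section gauge_gradient.
Context {R : realType} {m k : nat} (g : R).
Implicit Type z : 'rV[R]_(m + k).

Lemma enorm_xpart_powR z : 0 < sqx z -> (enorm (xpart z) `^ g) ^+ 2 = sqx z `^ g.
Proof.
move=> N0; rewrite enorm_xpart -powRrM -powR_mulrn ?powR_ge0// -powRrM.
by congr (_ `^ _); rewrite mulrAC mulVf ?mul1r// pnatr_eq0.
Qed.

Lemma gaugeS_gt0 z : 0 < sqx z -> 0 < gaugeS g z.
Proof.
move=> N0; rewrite ltr_pwDl ?powR_gt0//.
by rewrite mulr_ge0 ?sqr_ge0 ?sqy_ge0.
Qed.

Lemma gauge_gt0 z : 0 < sqx z -> 0 < gauge g z.
Proof. by move=> N0; rewrite gaugeE powR_gt0 ?gaugeS_gt0. Qed.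

(** The power 2 (1 + g) is split into squares, so that later cancellations are rational identities
    in gauge and gauge^g, within reach of [field]. *)
Lemma gaugeS_gauge z : 0 < g -> 0 < sqx z ->
  gaugeS g z = gauge g z ^+ 2 * (gauge g z `^ g) ^+ 2.
Proof.
move=> g0 N0; have S0 := gaugeS_gt0 z N0; have r0 := gauge_gt0 z N0.
have {1}-> : gaugeS g z = gauge g z `^ (2 * (1 + g)).
  by rewrite gaugeE -powRrM mulVf ?powRr1// ?ltW// mulf_neq0 ?pnatr_eq0//; lra.
move: (gauge g z) r0 => r r0.
have E : r * r `^ g = r `^ (1 + g).
  by rewrite powRD ?(gt_eqF r0) ?implybT// powRr1// ltW.
by rewrite -exprMn E -powR_mulrn ?powR_ge0// -powRrM mulrC.
Qed.

Lemma gaugeS_fctE : @gaugeS R m k g =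
  ((fun y => sqx y `^ (1 + g)) : 'rV[R]_(m + k) -> R) +
  (1 + g) ^+ 2 *: ((fun y => sqy y) : 'rV[R]_(m + k) -> R).
Proof. by apply/funext => y; rewrite /gaugeS. Qed.

Lemma is_derive_gaugeS z j : 0 < sqx z ->
  is_derive z (edir R j) (gaugeS g)
    ((1 + g) * sqx z `^ g * (\sum_(i < m) (lshift k i == j)%:R * (2 * z 0 (lshift k i)))
     + (1 + g) ^+ 2 * (\sum_(i < k) (rshift m i == j)%:R * (2 * z 0 (rshift m i)))).
Proof.
move=> N0.
have d1 : is_derive z (edir R j) (fun y : 'rV[R]_(m + k) => sqx y `^ (1 + g))
   ((1 + g) * sqx z `^ (1 + g - 1) * (\sum_(i < m) (lshift k i == j)%:R * (2 * z 0 (lshift k i)))).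
  apply: (@is_derive_comp_real R _ (@sqx R m k) (fun u => u `^ (1 + g))).
  - exact: differentiable_sumsq.
  - exact: is_derive_sumsq.
  - exact: is_derive1_powR.
have d2 := is_deriveZ ((1 + g) ^+ 2) (is_derive_sumsq (@rshift m k) z j).
rewrite gaugeS_fctE; apply: (is_derive_eq (is_deriveD d1 d2)).
by rewrite [1 + g - 1]addrAC subrr add0r.
Qed.

Lemma differentiable_gaugeS z : 0 < sqx z -> differentiable (@gaugeS R m k g) z.
Proof.
move=> N0.
rewrite gaugeS_fctE; apply: differentiableD; last by apply: differentiableZ; exact: differentiable_sumsq.
apply: (@differentiable_comp _ _ _ _ (@sqx R m k) (fun u => u `^ (1 + g))).
  exact: differentiable_sumsq.
by apply/derivable1_diffP; apply: ex_derive; exact: is_derive1_powR.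
Qed.

(** The exponent 1 / (2 (1 + g)) of the root cancels the factor 2 (1 + g) common to the derivatives
    of [gaugeS]. The Kronecker sums select coordinate [j] in whichever block it lies, so one formula
    serves x and y. *)
Lemma is_derive_gauge z j : 0 < g -> 0 < sqx z ->
  is_derive z (edir R j) (gauge g) (gauge g z / gaugeS g z *
    (sqx z `^ g * (\sum_(i < m) (lshift k i == j)%:R * z 0 (lshift k i))
     + (1 + g) * (\sum_(i < k) (rshift m i == j)%:R * z 0 (rshift m i)))).
Proof.
move=> g0 N0; have S0 := gaugeS_gt0 z N0.
pose e : R := (2 * (1 + g))^-1.
rewrite (_ : gauge g = (fun u => u `^ e) \o @gaugeS R m k g); last first.
  by apply/funext => y; rewrite gaugeE.
have d1 := is_derive_gaugeS z j N0.
have d2 : is_derive (gaugeS g z) 1 (fun u : R => u `^ e) (e * gaugeS g z `^ (e - 1)).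
  exact: is_derive1_powR.
have d := @is_derive_comp_real R _ (@gaugeS R m k g) (fun u => u `^ e) z (edir R j) _ _
  (differentiable_gaugeS z N0) d1 d2.
apply: is_derive_eq => /=.
rewrite powRD ?(gt_eqF S0) ?implybT// powR_inv1 ?ltW//.
have sum2 p (h : 'I_p -> 'I_(m + k)) : \sum_(i < p) (h i == j)%:R * (2 * z 0 (h i)) =
    2 * \sum_(i < p) (h i == j)%:R * z 0 (h i).
  by rewrite mulr_sumr; apply: eq_bigr => i _; rewrite mulrCA.
rewrite !sum2 /e; field.
by rewrite gt_eqF//= gt_eqF//; lra.
Qed.

(** With A = |x|^g, both blocks share the factor (gauge / gaugeS)^2 A^2, and what is left, A^2 |x|^2
    + (1 + g)^2 |y|^2, is [gaugeS] again. *)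
Lemma grad_gamma_gauge z : 0 < g -> 0 < sqx z ->
  grad_gamma_norm g (gauge g) z = enorm (xpart z) `^ g / gauge g z `^ g.
Proof.
move=> g0 N0; have S0 := gaugeS_gt0 z N0; have r0 := gauge_gt0 z N0.
set A := enorm (xpart z) `^ g.
have A2 : A ^+ 2 = sqx z `^ g by exact: enorm_xpart_powR.
rewrite /grad_gamma_norm /enorm big_split_ord /=.
have -> : \sum_(i < m) grad_gamma g (gauge g) z 0 (lshift k i) ^+ 2 =
   (gauge g z / gaugeS g z * A ^+ 2) ^+ 2 * sqx z.
  rewrite /sqx mulr_sumr; apply: eq_bigr => i _.
  rewrite mxE /= ltn_ord mul1r (derive_val (is_derive := is_derive_gauge z _ g0 N0)).
  rewrite (sumr_delta (@lshift m k))//; last exact: lshift_inj.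
  by rewrite big1 => [|j _]; [rewrite -A2; ring|rewrite eq_rlshift mul0r].
have -> : \sum_(i < k) grad_gamma g (gauge g) z 0 (rshift m i) ^+ 2 =
   (gauge g z / gaugeS g z * A) ^+ 2 * ((1 + g) ^+ 2 * sqy z).
  rewrite /sqy !mulr_sumr; apply: eq_bigr => i _.
  rewrite mxE /= ltnNge leq_addr /= (derive_val (is_derive := is_derive_gauge z _ g0 N0)).
  rewrite (sumr_delta (@rshift m k))//; last exact: rshift_inj.
  by rewrite big1 => [|j _]; [rewrite -/A; ring|rewrite eq_lrshift mul0r].
have SE : gaugeS g z = A ^+ 2 * sqx z + (1 + g) ^+ 2 * sqy z.
  rewrite /gaugeS A2; congr (_ + _).
  by rewrite addrC powRD ?(gt_eqF N0) ?implybT// powRr1 ?ltW.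
rewrite [X in Num.sqrt X](_ : _ = (A / gauge g z `^ g) ^+ 2).
  by rewrite sqrtr_sqr ger0_norm// divr_ge0 ?powR_ge0.
transitivity ((gauge g z / gaugeS g z) ^+ 2 * A ^+ 2 * gaugeS g z).
  by rewrite [X in _ = _ * X]SE; ring.
rewrite [gaugeS g z]gaugeS_gauge//.
field.
by rewrite (gt_eqF r0) (gt_eqF (powR_gt0 _ r0)).
Qed.

(* Cauchy-Schwarz, as [|x|^g (E f)] is the scalar product of [grad_gamma f] with a vector whose squared length is [gaugeS]. *)
Lemma euler_grad_gamma (f : 'rV[R]_(m + k) -> R) z : 0 < sqx z ->
  (enorm (xpart z) `^ g * euler (dilexp m k g) f z) ^+ 2 <= gaugeS g z * grad_gamma_norm g f z ^+ 2.
Proof.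
move=> N0; have S0 := gaugeS_gt0 z N0.
set A := enorm (xpart z) `^ g.
have A2 : A ^+ 2 = sqx z `^ g by exact: enorm_xpart_powR.
pose u (i : 'I_(m + k)) := if (i < m)%N then A * z 0 i else (1 + g) * z 0 i.
pose v := grad_gamma g f z.
have -> : A * euler (dilexp m k g) f z = \sum_i u i * v 0 i.
  rewrite /euler mulr_sumr; apply: eq_bigr => i _.
  by rewrite /u /dilexp mxE -/A; case: ifP => _; ring.
have -> : grad_gamma_norm g f z ^+ 2 = \sum_i v 0 i ^+ 2.
  by rewrite /grad_gamma_norm /enorm sqr_sqrtr// sumr_ge0// => i _; exact: sqr_ge0.
have SE : gaugeS g z = \sum_i u i ^+ 2.
  rewrite big_split_ord /= /gaugeS; congr (_ + _).
    rewrite addrC powRD ?(gt_eqF N0) ?implybT// powRr1 ?ltW// -A2 mulr_sumr.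
    by apply: eq_bigr => i _; rewrite /u /= ltn_ord exprMn.
  rewrite mulr_sumr; apply: eq_bigr => i _.
  by rewrite /u /= ltnNge leq_addr /= exprMn.
set P := gaugeS g z in S0 SE *; set B := \sum_i u i * v 0 i; set Q := \sum_i v 0 i ^+ 2.
(* The squared length of P v - B u, where P = |u|^2 and B is the scalar product of u and v, equals P
   (P Q - B^2); dividing by P > 0 is Cauchy-Schwarz. *)
have : 0 <= \sum_i (P * v 0 i - B * u i) ^+ 2 by rewrite sumr_ge0// => i _; exact: sqr_ge0.
have -> : \sum_i (P * v 0 i - B * u i) ^+ 2 = P * (P * Q - B ^+ 2).
  transitivity (\sum_i (P ^+ 2 * v 0 i ^+ 2 - 2 * P * B * (u i * v 0 i) + B ^+ 2 * u i ^+ 2)).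
    by apply: eq_bigr => i _; ring.
  by rewrite big_split sumrB -!mulr_sumr -SE -/B -/Q /=; ring.
by rewrite pmulr_rge0// subr_ge0.
Qed.

End gauge_gradient.

(** * The Hardy identity *)

(** The orbit identity for U(s) = e^(b s) f(dil s z), multiplied by W(z) and integrated in z. As U'
    = e^(b s) (E f + b f), both orbit integrals carry the exponent a + 2 b, so [tonelli_dil]
    produces the same [k] on both sides. It is used with b = 0 for the Hardy identity and with b = s
    for the weighted inequality. *)
Lemma hardy_identity {R : realType} {n} (mu : {measure set (Rn R n) -> \bar R})
    (c : 'I_n -> R) (f : 'rV[R]_n -> R) (W : Rn R n -> R) (w a b : R) :
  lebesgue_Rn mu -> measurable_fun [set: Rn R n] W -> (forall z, 0 <= W z) ->
  (forall s z, W (dil c s z) = expR (w * s) * W z) ->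
  (forall z, differentiable f z) -> continuous (euler c f) ->
  (forall z, W z != 0 -> exists2 M, 0 < M &
     forall s, M <= s -> f (dil c s z) = 0 /\ euler c f (dil c s z) = 0) ->
  0 <= a -> 0 < \sum_i c i + w - (a + 2 * b) ->
  let k := (\sum_i c i + w - (a + 2 * b))^-1 in
  (a%:E * \int[mu]_z (W z * f z ^+ 2)%:E +
   k%:E * \int[mu]_z (W z * (euler c f z + (a + b) * f z) ^+ 2)%:E
   = k%:E * \int[mu]_z (W z * (euler c f z + b * f z) ^+ 2)%:E)%E.
Proof.
move=> Hmu mW W0 HW df cE supp a0 k0 k.
have cf : continuous f by move=> z; exact: differentiable_continuous.
have mf := continuous_measurable_Rn R n f cf.
have mE := continuous_measurable_Rn R n _ cE.
have mF r : measurable_fun [set: Rn R n] (fun z => (euler c f z + r * f z) ^+ 2).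
  by apply: measurable_funX; apply: measurable_funD => //; exact: measurable_funM.
have F0 r (z : Rn R n) : 0 <= (euler c f z + r * f z) ^+ 2 by exact: sqr_ge0.
(* Read backwards, [tonelli_dil] turns both sides into integrals over z of orbit integrals, and the
   claim becomes an equality of integrands. *)
rewrite -!(tonelli_dil mu c W _ w)// -ge0_integralZl_EFin//; last 2 first.
- by move=> z _; rewrite lee_fin mulr_ge0 ?sqr_ge0.
- by apply/measurable_EFinP; apply: measurable_funM => //; exact: measurable_funX.
have orbit_ge0 r (z : Rn R n) : (0 <= \int[lebesgue_measure]_(s in `[0%R, +oo[)
     (expR ((a + 2 * b) * s) * (euler c f (dil c s z) + r * f (dil c s z)) ^+ 2)%:E)%E.
  by apply: integral_ge0 => s _; rewrite lee_fin mulr_ge0 ?expR_ge0.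
rewrite -ge0_integralD//; last 4 first.
- by move=> z _; rewrite mule_ge0 ?lee_fin// mulr_ge0 ?sqr_ge0.
- apply/measurable_EFinP; do 2 apply: measurable_funM => //; exact: measurable_funX.
- by move=> z _; rewrite mule_ge0 ?lee_fin.
- apply: emeasurable_funM; first exact/measurable_EFinP.
  exact: (measurable_orbit_integral c (fun z => (euler c f z + (a + b) * f z) ^+ 2) _ (mF _) (F0 _)).
apply: eq_integral => z _.
(* Where [W] vanishes both sides are 0. In the applications this covers the origin, whose orbit is
   constant and never leaves the support. *)
have [->|Wz] := eqVneq (W z) 0; first by rewrite !mul0r !mul0e mule0 adde0.
have [M M0 HM] := supp z Wz.
have dE (s : R) := is_derive_expRM b s.
pose U s := expR (b * s) * f (dil c s z).
pose V s := expR (b * s) * (euler c f (dil c s z) + b * f (dil c s z)).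
have dU (s : R) : is_derive s 1 U (V s).
  have d2 := is_derive_dil c f z s (df _).
  rewrite (_ : U = (fun s : R => expR (b * s)) * (fun s : R => f (dil c s z)))//.
  by apply: is_derive_eq; rewrite /GRing.scale /V /=; ring.
have cdil : continuous (fun s : R => dil c s z).
  move=> s; apply: differentiable_continuous; apply/derivable1_diffP.
  apply/derivable_mxP => i j; rewrite (ord1 i).
  rewrite (_ : (fun _ => _) = (fun u : R => expR (c j * u) * z 0 j)); last first.
    by apply/funext => u; rewrite mxE.
  have dj := is_derive_expRM (c j) s.
  exact: ex_derive.
have ceb := continuous_is_derive _ _ (is_derive_expRM b).
have cV : continuous V.
  move=> s; apply: (@continuousM _ _ (fun s => expR (b * s))
    (fun s => euler c f (dil c s z) + b * f (dil c s z))); first exact: ceb.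
  apply: (@continuousD _ _ _ (fun s => euler c f (dil c s z)) (fun s => b * f (dil c s z))).
    exact: (continuous_comp (cdil s) (cE _)).
  apply: (@continuousM _ _ (fun=> b) (fun s => f (dil c s z))); first exact: cst_continuous.
  exact: (continuous_comp (cdil s) (cf _)).
have UM s : M <= s -> U s = 0 by move=> /HM[h1 _]; rewrite /U h1 mulr0.
have VM s : M <= s -> V s = 0 by move=> /HM[h1 h2]; rewrite /V h1 h2 mulr0 addr0 mulr0.
have := weighted_square_identity U V a M M0 dU cV UM VM.
have dil0 : dil c 0 z = z by apply/rowP => i; rewrite mxE mulr0 expR0 mul1r.
have expE s : expR ((a + 2 * b) * s) = expR (a * s) * expR (b * s) ^+ 2.
  by rewrite expr2 -!expRD; congr expR; ring.
rewrite {1}/U mulr0 expR0 mul1r dil0 => H.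
transitivity ((W z)%:E * ((a * f z ^+ 2)%:E + \int[lebesgue_measure]_(s in `[0%R, +oo[)
    (expR (a * s) * (V s + a * U s) ^+ 2)%:E))%E.
  have I0 : (0 <= \int[lebesgue_measure]_(s in `[0%R, +oo[)
      (expR (a * s) * (V s + a * U s) ^+ 2)%:E)%E.
    by apply: integral_ge0 => s _; rewrite lee_fin mulr_ge0 ?expR_ge0 ?sqr_ge0.
  have a0f : (0 <= (a * f z ^+ 2)%:E)%E by rewrite lee_fin mulr_ge0 ?sqr_ge0.
  rewrite (ge0_muleDr _ a0f I0).
  rewrite -!EFinM mulrCA; congr (_ + _ * _)%E.
  by apply: eq_integral => s _; rewrite expE /U /V; congr EFin; ring.
rewrite H; congr (_ * _)%E.
by apply: eq_integral => s _; rewrite expE /V; congr EFin; ring.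
Qed.

(** * Integrability of powers of the gauge *)

Lemma measurable_fun_powR {d} {T : measurableType d} {R : realType} (f : T -> R) (p : R) :
  measurable_fun [set: T] f -> measurable_fun [set: T] (fun x => f x `^ p).
Proof. exact: (measurableT_comp (measurable_powR p)). Qed.

(** Hoelder with exponents 1/h and 1/(1 - h) for the factorization X^h = (X v)^h (v^(-h) 1_D), then
    raised to the power 1/h. *)
Lemma hoelder_weight {d} {T : measurableType d} {R : realType}
    (mu : {measure set T -> \bar R}) (D : set T) (X v : T -> R) (h : R) :
  0 < h < 1 -> measurable D ->
  measurable_fun [set: T] X -> measurable_fun [set: T] v ->
  (forall z, 0 <= X z) -> (forall z, 0 <= v z) ->
  (forall z, X z != 0 -> D z /\ 0 < v z) ->
  ((\int[mu]_z (X z `^ h)%:E) `^ h^-1 <=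
   \int[mu]_z (X z * v z)%:E *
     (\int[mu]_(z in D) (v z `^ (- (h / (1 - h))))%:E) `^ ((1 - h) / h))%E.
Proof.
move=> /andP[h0 h1] mD mX mv X0 v0 XD.
have h1' : 0 < 1 - h by rewrite subr_gt0.
pose f z := (X z * v z) `^ h; pose g z := v z `^ (- h) * \1_D z.
have mf : measurable_fun [set: T] f.
  by apply: measurable_fun_powR; exact: measurable_funM.
have mg : measurable_fun [set: T] g.
  apply: measurable_funM; last exact: measurable_indic.
  exact: measurable_fun_powR.
have h0i : 0 < h^-1 by rewrite invr_gt0.
have h1i : 0 < (1 - h)^-1 by rewrite invr_gt0.
have := hoelder mu mf mg h0i h1i.
rewrite !invrK subrKC => /(_ erefl).
rewrite Lnorm1 [X in (X <= _)%E](_ : _ = \int[mu]_z (X z `^ h)%:E)%E; last first.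
  apply: eq_integral => z _ /=; rewrite /f /g indicE ger0_norm ?mulr_ge0 ?powR_ge0//.
  have [->|Xz] := eqVneq (X z) 0; first by rewrite mul0r powR0 ?mul0r// gt_eqF.
  have [Dz vz] := XD z Xz; rewrite mem_set// mulr1 powRM// -mulrA -powRD ?(gt_eqF vz) ?implybT//.
  by rewrite subrr powRr0 mulr1.
rewrite unlock !invrK.
rewrite [X in (_ <= X `^ _ * _)%E](_ : _ = \int[mu]_z (X z * v z)%:E)%E; last first.
  apply: eq_integral => z _ /=; rewrite /f ger0_norm ?powR_ge0//.
  by rewrite -powRrM mulfV ?gt_eqF// powRr1// mulr_ge0.
rewrite [X in (_ <= _ * X `^ _)%E](_ : _ = \int[mu]_(z in D) (v z `^ (- (h / (1 - h))))%:E)%E; last first.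
  rewrite [RHS]integral_mkcond; apply: eq_integral => z _ /=.
  rewrite /g patchE indicE ger0_norm ?mulr_ge0 ?powR_ge0//; case: ifP => _ /=.
    by rewrite mulr1 -powRrM mulNr.
  by rewrite mulr0 powR0// gt_eqF.
have I0 : (0 <= \int[mu]_z (X z * v z)%:E)%E.
  by apply: integral_ge0 => z _; rewrite lee_fin mulr_ge0.
have J0 : (0 <= \int[mu]_(z in D) (v z `^ (- (h / (1 - h))))%:E)%E.
  by apply: integral_ge0 => z _; rewrite lee_fin powR_ge0.
have K0 : (0 <= \int[mu]_z (X z `^ h)%:E)%E.
  by apply: integral_ge0 => z _; rewrite lee_fin powR_ge0.
move=> /(gt0_ler_poweR (ltW h0i)); rewrite !in_itv /= !leey !K0 mule_ge0 ?poweR_ge0// => /(_ isT isT).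
by rewrite poweRM ?poweR_ge0// -!poweRrM mulfV ?gt_eqF// poweRe1.
Qed.

Lemma powR_expRM {R : realType} (u a x : R) : 0 <= x ->
  (expR u * x) `^ a = expR (u * a) * x `^ a.
Proof.
move=> x0; rewrite powRM ?expR_ge0//; congr (_ * _).
by rewrite /powR gt_eqF ?expR_gt0// expRK mulrC.
Qed.

Section gauge_homogeneity.
Context {R : realType} {m k : nat} (g : R).
Hypothesis g0 : 0 < g.
Implicit Type z : 'rV[R]_(m + k).
Let c : 'I_(m + k) -> R := dilexp m k g.

Let g1 : 0 < 1 + g. Proof. by rewrite addr_gt0. Qed.

Let g1_neq0 : 1 + g != 0. Proof. by rewrite gt_eqF. Qed.

Lemma sum_dilexp : \sum_i c i = homdim m k g.
Proof.
rewrite big_split_ord /= /homdim.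
rewrite (eq_bigr (fun=> 1)); last by move=> i _; rewrite /c /dilexp /= ltn_ord.
rewrite [X in _ + X](eq_bigr (fun=> 1 + g)); last first.
  by move=> i _; rewrite /c /dilexp /= ltnNge leq_addr.
by rewrite !sumr_const !card_ord mulr_natr.
Qed.

Lemma sqx_dil s z : sqx (dil c s z) = expR (2 * s) * sqx z.
Proof.
rewrite /sqx mulr_sumr; apply: eq_bigr => i _.
by rewrite mxE exprMn -expRM_natl /c /dilexp /= ltn_ord mul1r.
Qed.

Lemma sqy_dil s z : sqy (dil c s z) = expR (2 * (1 + g) * s) * sqy z.
Proof.
rewrite /sqy mulr_sumr; apply: eq_bigr => i _.
by rewrite mxE exprMn -expRM_natl /c /dilexp /= ltnNge leq_addr mulrA.
Qed.

Lemma gauge_dil s z : gauge g (dil c s z) = expR s * gauge g z.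
Proof.
rewrite !gaugeE {1}/gaugeS sqx_dil sqy_dil powR_expRM ?sqx_ge0//.
rewrite [X in X `^ _ = _](_ : _ = expR (2 * (1 + g) * s) * gaugeS g z).
  by rewrite powR_expRM ?gaugeS_ge0//; congr (expR _ * _); field.
by rewrite /gaugeS (_ : 2 * s * (1 + g) = 2 * (1 + g) * s); ring.
Qed.

Lemma enorm_xpart_dil s z : enorm (xpart (dil c s z)) = expR s * enorm (xpart z).
Proof.
rewrite !enorm_xpart sqx_dil powR_expRM ?sqx_ge0//; congr (expR _ * _).
by rewrite mulrAC mulfV ?mul1r ?pnatr_eq0.
Qed.

Lemma gauge_ge0 z : 0 <= gauge g z.
Proof. exact: powR_ge0. Qed.

Lemma measurable_sqx : measurable_fun [set: Rn R (m + k)] (@sqx R m k).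
Proof.
apply: measurable_sum => i; apply: measurable_funX; exact: measurable_coord.
Qed.

Lemma measurable_sqy : measurable_fun [set: Rn R (m + k)] (@sqy R m k).
Proof.
apply: measurable_sum => i; apply: measurable_funX; exact: measurable_coord.
Qed.

Lemma measurable_enorm_xpart :
  measurable_fun [set: Rn R (m + k)] (fun z => enorm (@xpart R m k z)).
Proof.
under eq_fun do rewrite enorm_xpart.
exact: measurable_fun_powR measurable_sqx.
Qed.

Lemma measurable_gauge : measurable_fun [set: Rn R (m + k)] (@gauge R m k g).
Proof.
rewrite (funext (@gaugeE R m k g)).
apply: measurable_fun_powR; apply: measurable_funD.
  exact: measurable_fun_powR measurable_sqx.
by apply: measurable_funM => //; exact: measurable_sqy.
Qed.

Lemma sqx_gauge z : sqx z <= gauge g z ^+ 2.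
Proof.
have -> : sqx z = (sqx z `^ (1 + g)) `^ ((1 + g)^-1).
  by rewrite -powRrM mulfV ?powRr1 ?sqx_ge0.
rewrite -(powR_mulrn 2 (gauge_ge0 z)) gaugeE -[X in _ <= X]powRrM.
rewrite invfM mulrAC mulVf ?pnatr_eq0// mul1r.
apply: ge0_ler_powR; rewrite ?nnegrE ?powR_ge0 ?gaugeS_ge0//; first by rewrite invr_ge0 ltW.
by rewrite /gaugeS lerDl mulr_ge0 ?sqr_ge0 ?sqy_ge0.
Qed.

Lemma gaugeS_powR z : gaugeS g z = gauge g z `^ (2 * (1 + g)).
Proof.
by rewrite gaugeE -powRrM mulVf ?powRr1 ?gaugeS_ge0// mulf_neq0 ?pnatr_eq0.
Qed.

Lemma sqy_gauge z : sqy z <= gauge g z `^ (2 * (1 + g)).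
Proof.
rewrite -gaugeS_powR; apply: (@le_trans _ _ ((1 + g) ^+ 2 * sqy z)).
  by rewrite ler_peMl ?sqy_ge0// exprn_ege1// lerDl ltW.
by rewrite lerDr powR_ge0.
Qed.

Lemma gauge_ball_sub_hbox (M : R) : 0 <= M ->
  [set z : Rn R (m + k) | @gauge R m k g z < M] `<=`
  hbox (const_mx (- (1 + M ^+ 2 + M `^ (2 * (1 + g))))) (const_mx (1 + M ^+ 2 + M `^ (2 * (1 + g)))).
Proof.
move=> M0 z /= zM i; rewrite !mxE.
have r0 := gauge_ge0 z.
have : z 0 i ^+ 2 < 1 + M ^+ 2 + M `^ (2 * (1 + g)).
  have h1 : gauge g z ^+ 2 <= M ^+ 2 by rewrite ler_pXn2r// ?nnegrE// ltW.
  have h2 : gauge g z `^ (2 * (1 + g)) <= M `^ (2 * (1 + g)).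
    by apply: ge0_ler_powR; rewrite ?nnegrE//; [rewrite mulr_ge0// ltW|exact: ltW].
  have M2 := sqr_ge0 M; have Mg := powR_ge0 M (2 * (1 + g)).
  case: (split_ordP i) => j ->.
    have : z 0 (lshift k j) ^+ 2 <= sqx z.
      by rewrite /sqx (bigD1 j)//= lerDl sumr_ge0// => l _; exact: sqr_ge0.
    by have := sqx_gauge z; lra.
  have : z 0 (rshift m j) ^+ 2 <= sqy z.
    by rewrite /sqy (bigD1 j)//= lerDl sumr_ge0// => l _; exact: sqr_ge0.
  by have := sqy_gauge z; lra.
have M2 := sqr_ge0 M; have Mg := powR_ge0 M (2 * (1 + g)).
(* A bound on the square that is at least 1 also bounds the absolute value. Such a crude box is
   enough, as only the finiteness of the measure of gauge balls matters. *)
have b1 : 1 <= 1 + M ^+ 2 + M `^ (2 * (1 + g)) by lra.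
move: (1 + M ^+ 2 + M `^ (2 * (1 + g))) b1 => b b1 zb.
by apply/andP; split; nra.
Qed.

Lemma gauge_bounded (Om : set 'rV[R]_(m + k)) : bounded_set Om ->
  exists2 M, 0 < M & forall z, Om z -> gauge g z <= M.
Proof.
move=> [B [_ HB]].
(* Every real above [B] bounds the max norm on [Om], hence each coordinate; this one is moreover
   positive. *)
pose b : R := `|B| + 1.
have Hb z : Om z -> forall i, z 0 i ^+ 2 <= b ^+ 2.
  move=> Oz i; have bB : B < b by rewrite /b ltr_pwDr// ler_norm.
  have := HB b bB z Oz; rewrite /= /Num.Def.normr /= mx_normrE => nz.
  have h : `|z 0 i| <= b.
    by apply: le_trans nz; exact: (le_bigmax _ (fun ij => `|z ij.1 ij.2|) (0, i)).
  by rewrite -real_normK ?num_real// ler_pXn2r// ?nnegrE// /b addr_ge0.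
pose S : R := (\sum_(i < m) b ^+ 2) `^ (1 + g) + (1 + g) ^+ 2 * \sum_(i < k) b ^+ 2.
exists (S `^ (2 * (1 + g))^-1 + 1) => [|z Oz]; first by rewrite ltr_wpDl ?powR_ge0.
have hx : sqx z <= \sum_(i < m) b ^+ 2 by apply: ler_sum => i _; exact: Hb.
have hy : sqy z <= \sum_(i < k) b ^+ 2 by apply: ler_sum => i _; exact: Hb.
have hs : gaugeS g z <= S.
  apply: lerD; last by rewrite ler_wpM2l ?sqr_ge0.
  by apply: ge0_ler_powR; rewrite ?nnegrE ?sqx_ge0//; [exact: ltW|exact: le_trans (sqx_ge0 z) hx].
rewrite gaugeE ler_wpDr//; apply: ge0_ler_powR; rewrite ?nnegrE ?gaugeS_ge0//.
- by rewrite invr_ge0 mulr_ge0// ltW.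
- exact: le_trans (gaugeS_ge0 _ z) hs.
Qed.

(** Tonelli on orbits replaces polar coordinates: with W = 1 and F the indicator of the gauge ball
    [B] of radius e M, it gives int I = mu(B) / (Q - p). If z has gauge r with 0 < r <= M, its orbit
    lies in [B] for s in [L, L + 1), L = ln (M / r), where e^(p s) >= (M / r)^p. Hence r^(-p) <=
    M^(-p) I(z). *)
Lemma integral_gauge_powR (mu : {measure set (Rn R (m + k)) -> \bar R})
    (Om : set (Rn R (m + k))) (M p : R) :
  lebesgue_Rn mu -> measurable Om -> 0 < M -> (forall z, Om z -> gauge g z <= M) ->
  0 < p < homdim m k g ->
  (\int[mu]_(z in Om) (gauge g z `^ (- p))%:E < +oo)%E.
Proof.
move=> Hmu mOm M0 OM /andP[p0 pQ].
pose B : set (Rn R (m + k)) := [set z : Rn R (m + k) | @gauge R m k g z < expR 1 * M].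
have eM0 : 0 <= expR 1 * M by rewrite mulr_ge0 ?expR_ge0// ltW.
have mB : measurable B.
  rewrite (_ : B = (@gauge R m k g) @^-1` `]-oo, (expR 1 * M)[%classic); last first.
    by apply/seteqP; split=> z /=; rewrite in_itv.
  by rewrite -[X in measurable X]setTI; exact: measurable_gauge.
have Bfin : (mu B < +oo)%E.
  apply: le_lt_trans (lebesgue_hbox_lty _ _ mu (const_mx (- (1 + (expR 1 * M) ^+ 2 + (expR 1 * M) `^ (2 * (1 + g)))))
    (const_mx (1 + (expR 1 * M) ^+ 2 + (expR 1 * M) `^ (2 * (1 + g)))) Hmu).
  apply: le_measure; rewrite ?inE//; first exact: measurable_hbox.
  exact: gauge_ball_sub_hbox.
have F0 z : 0 <= \1_B z :> R by [].
have mF : measurable_fun [set: Rn R (m + k)] (\1_B : Rn R (m + k) -> R).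
  exact: measurable_indic.
pose I z := (\int[lebesgue_measure]_(s in `[0%R, +oo[) (expR (p * s) * \1_B (dil c s z))%:E)%E.
have mI : measurable_fun [set: Rn R (m + k)] I by exact: measurable_orbit_integral.
have I0 z : (0 <= I z)%E by apply: integral_ge0 => s _; rewrite lee_fin mulr_ge0 ?expR_ge0.
have ler z : Om z -> ((gauge g z `^ (- p))%:E <= (M `^ (- p))%:E * I z)%E.
  (* At gauge 0 the power with exponent -p is 0 by convention, as p is nonzero, so the bound is
     trivial there. *)
  move=> Oz; have := gauge_ge0 z; rewrite le_eqVlt => /predU1P[<-|r0].
    by rewrite powR0 ?oppr_eq0 ?gt_eqF// mule_ge0// lee_fin powR_ge0.
  pose L : R := ln (M / gauge g z).
  have L0 : 0 <= L by rewrite ln_ge0// ler_pdivlMr// mul1r OM.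
  have EL : expR L = M / gauge g z by rewrite lnK// posrE divr_gt0.
  apply: (@le_trans _ _ ((M `^ (- p))%:E * \int[lebesgue_measure]_(s in `[L, (L + 1)%R[) (expR (p * L))%:E)%E).
    have -> : (\int[lebesgue_measure]_(s in `[L, (L + 1)%R[) (expR (p * L))%:E = (expR (p * L))%:E)%E.
      have E1 : lebesgue_measure (`[L, L + 1[%classic : set R) = 1%E.
        rewrite lebesgue_measure_itv /= lte_fin ltrDl ltr01 -EFinB.
        by rewrite addrAC subrr add0r.
      by rewrite -[RHS]mule1 -E1; exact: integral_cst.
    rewrite -EFinM lee_fin.
    have -> : M = expR L * gauge g z by rewrite EL divfK// gt_eqF.
    rewrite (powR_expRM _ _ _ (ltW r0)) mulrAC -expRD.
    by rewrite mulrN [p * L]mulrC addNr expR0 mul1r.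
  rewrite lee_wpmul2l ?lee_fin ?powR_ge0//.
  have mIz : measurable_fun [set: measurableTypeR R] (fun s => (expR (p * s) * \1_B (dil c s z))%:E).
    apply/measurable_EFinP/measurable_funM.
      by apply: measurableT_comp => //; exact: measurable_funM.
    exact: measurableT_comp mF (@measurable_orbit R _ c _ (measurableTypeR R)
      (fun=> z) (fun s => s) (measurable_cst _) (@measurable_id _ _ _)).
  apply: (@le_trans _ _ (\int[lebesgue_measure]_(s in `[L, (L + 1)%R[) (expR (p * s) * \1_B (dil c s z))%:E)%E).
    apply: ge0_le_integral => //; first exact: measurable_funTS.
    move=> s /=; rewrite in_itv /= => /andP[Ls sL]; rewrite lee_fin.
      rewrite indicE mem_set ?mulr1; first by rewrite ler_expR ler_pM2l.
      rewrite /B /= gauge_dil -[M](divfK (lt0r_neq0 r0)) -EL mulrA ltr_pM2r// -expRD.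
      by rewrite ltr_expR addrC.
  apply: ge0_subset_integral => //.
  - exact: measurable_funTS.
  - by move=> s /=; rewrite !in_itv /= andbT => /andP[Ls _]; exact: le_trans Ls.
apply: (@le_lt_trans _ _ (\int[mu]_(z in Om) ((M `^ (- p))%:E * I z))%E).
  apply: ge0_le_integral => //.
  - by move=> z _; rewrite lee_fin powR_ge0.
  - apply/measurable_funTS/measurable_EFinP.
    exact: measurable_fun_powR measurable_gauge.
  - by apply/measurable_funTS/emeasurable_funM.
rewrite ge0_integralZl_EFin ?powR_ge0//; last exact: measurable_funTS.
apply: (@le_lt_trans _ _ ((M `^ (- p))%:E * \int[mu]_z I z)%E).
  by rewrite lee_wpmul2l ?lee_fin ?powR_ge0//; apply: ge0_subset_integral.
have W1 (s : R) (z : 'rV[R]_(m + k)) : 1 = expR (0 * s) * 1 :> R by rewrite mul0r expR0 mulr1.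
have Qp : 0 < \sum_i c i + 0 - p by rewrite addr0 sum_dilexp subr_gt0.
have E := @tonelli_dil R (m + k) mu c (fun=> 1) (\1_B) 0 p Hmu (measurable_cst _) mF (fun=> ler01) F0 W1 Qp.
rewrite addr0 sum_dilexp [X in _ = (_ * X)%E](_ : _ = mu B) in E; last first.
  by under eq_integral do rewrite mul1r; rewrite integral_indic// setIT.
rewrite (_ : (\int[mu]_z I z)%E = ((homdim m k g - p)^-1)%:E * mu B)%E; last first.
  by rewrite -E; apply: eq_integral => z _; rewrite mul1e.
by rewrite lte_mul_pinfty ?lee_fin ?powR_ge0// lte_mul_pinfty// lee_fin invr_ge0 subr_ge0 ltW.
Qed.

End gauge_homogeneity.

(** * Test functions and weights *)

Section test_functions.
Context {R : realType} {n : nat} (Om : set 'rV[R]_n) (f : 'rV[R]_n -> R).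
Hypothesis tf : test_fun Om f.

Lemma test_fun_differentiable z : differentiable f z.
Proof. by have [sm _] := tf; exact: (sm [::]). Qed.

Lemma test_fun_continuous_derive v : continuous (fun z => 'D_v f z).
Proof. by have [sm _] := tf; move=> z; exact: differentiable_continuous (sm [:: v] z). Qed.

(** The complement of the closed support is open, so [f] vanishes near such a point, boundary points
    of [Om] included, and its derivatives vanish with it. *)
Lemma test_fun_out z : ~ Om z -> f z = 0 /\ forall v, 'D_v f z = 0.
Proof.
move=> Oz; have [_ [_ sub]] := tf.
have nz : \forall y \near z, f y = 0.
  have : nbhs z (~` closure [set y | f y != 0]).
    apply: open_nbhs_nbhs; split; first exact/closed_openC/closed_closure.
    by move=> /sub.
  apply: filterS => y; apply: contra_notP => /eqP fy; exact: subset_closure.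
split; first exact: nbhs_singleton nz.
move=> v; rewrite (@near_eq_derive _ _ _ f (cst 0) z v nz).
exact: derive_cst.
Qed.

Lemma test_fun_continuous_euler c : continuous (euler c f).
Proof.
rewrite /euler; apply: continuous_big => [|i _ z]; first exact: add_continuous.
apply: (@continuousM R 'rV[R]_n (fun y => c i * y 0 i) (fun y => 'D_(edir R i) f y) z); last first.
  exact: test_fun_continuous_derive.
apply: (@continuousM R 'rV[R]_n (fun=> c i) (fun y => y 0 i) z).
  exact: cst_continuous.
exact: coord_continuous.
Qed.

Lemma euler_out c z : ~ Om z -> euler c f z = 0.
Proof.
by move=> /test_fun_out[_ d0]; rewrite /euler big1// => i _; rewrite d0 mulr0.
Qed.

Lemma measurable_test_fun : measurable_fun [set: Rn R n] f.
Proof.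
apply: continuous_measurable_Rn => z; apply: differentiable_continuous.
exact: test_fun_differentiable.
Qed.

Lemma measurable_euler c : measurable_fun [set: Rn R n] (euler c f).
Proof. exact: continuous_measurable_Rn (test_fun_continuous_euler c). Qed.

End test_functions.

Lemma grad_gamma_norm_out {R : realType} {m k} (g : R) (Om : set 'rV[R]_(m + k)) f z :
  test_fun Om f -> ~ Om z -> grad_gamma_norm g f z = 0.
Proof.
move=> tf /(test_fun_out _ _ tf)[_ d0]; rewrite /grad_gamma_norm /enorm big1 ?sqrtr0// => i _.
by rewrite mxE d0 mulr0 expr0n.
Qed.

Lemma measurable_grad_gamma_norm {R : realType} {m k} (g : R) (Om : set 'rV[R]_(m + k)) f :
  test_fun Om f -> measurable_fun [set: Rn R (m + k)] (grad_gamma_norm g f).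
Proof.
move=> tf.
have -> : grad_gamma_norm g f = fun z => (\sum_i (grad_gamma g f z) 0 i ^+ 2) `^ 2^-1.
  by apply/funext => z; exact: enormX.
apply: measurable_fun_powR; apply: measurable_sum => i; apply: measurable_funX.
have -> : (fun z => grad_gamma g f z 0 i) =
    fun z => (if (i < m)%N then 1 else enorm (xpart z) `^ g) * 'D_(edir R i) f z.
  by apply/funext => z; rewrite mxE.
apply: measurable_funM; last exact: continuous_measurable_Rn (test_fun_continuous_derive _ _ tf _).
case: (i < m)%N; first exact: measurable_cst.
exact: measurable_fun_powR measurable_enorm_xpart.
Qed.

Section weights.
Context {R : realType} {m k : nat} (g al t : R).
Hypothesis g0 : 0 < g.
Implicit Type z : 'rV[R]_(m + k).

(** The value of the gauge gradient norm off {x = 0}, taken as a definition everywhere: in this form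
    it is measurable and invariant under dilations. *)
Definition slope z : R := enorm (xpart z) `^ g / gauge g z `^ g.

(* The last factor is 1 off the origin, where it is 0 because x / 0 = 0. *)
Definition wgt z : R := gauge g z `^ al * slope z `^ t * (gauge g z / gauge g z).

Definition hwgt z : R := gauge g z `^ al * slope z `^ (t + 2) / gauge g z ^+ 2.

Lemma wgt_ge0 z : 0 <= wgt z.
Proof. by rewrite mulr_ge0 ?divr_ge0 ?gauge_ge0// mulr_ge0 ?powR_ge0. Qed.

Lemma wgtE z : 0 < gauge g z -> wgt z = gauge g z `^ al * slope z `^ t.
Proof. by move=> r0; rewrite /wgt divff ?mulr1// gt_eqF. Qed.

Lemma hwgt_ge0 z : 0 <= hwgt z.
Proof. by rewrite divr_ge0 ?mulr_ge0 ?powR_ge0 ?sqr_ge0. Qed.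

Lemma measurable_slope : measurable_fun [set: Rn R (m + k)] slope.
Proof.
rewrite (_ : slope = fun z => enorm (xpart z) `^ g * (gauge g z `^ g) `^ (-1)).
  apply: measurable_funM; first exact: measurable_fun_powR measurable_enorm_xpart.
  by do 2 apply: measurable_fun_powR; exact: measurable_gauge.
by apply/funext => z; rewrite /slope powR_inv1 ?powR_ge0.
Qed.

Lemma measurable_wgt : measurable_fun [set: Rn R (m + k)] wgt.
Proof.
have mr := @measurable_gauge R m k g.
rewrite (_ : wgt = fun z => gauge g z `^ al * slope z `^ t * (gauge g z * gauge g z `^ (-1))).
  apply: measurable_funM; last by apply: measurable_funM => //; exact: measurable_fun_powR.
  apply: measurable_funM; apply: measurable_fun_powR => //; exact: measurable_slope.
by apply/funext => z; rewrite /wgt powR_inv1 ?gauge_ge0.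
Qed.

Lemma measurable_hwgt : measurable_fun [set: Rn R (m + k)] hwgt.
Proof.
rewrite (_ : hwgt = fun z => gauge g z `^ al * slope z `^ (t + 2) * (gauge g z ^+ 2) `^ (-1)).
  apply: measurable_funM.
    apply: measurable_funM; apply: measurable_fun_powR; [exact: measurable_gauge|exact: measurable_slope].
  by apply/measurable_fun_powR/measurable_funX; exact: measurable_gauge.
by apply/funext => z; rewrite /hwgt powR_inv1 ?sqr_ge0.
Qed.

Lemma slope_dil s z : slope (dil (dilexp m k g) s z) = slope z.
Proof.
rewrite /slope gauge_dil// enorm_xpart_dil !powR_expRM ?gauge_ge0 ?sqrtr_ge0// invfM mulrACA.
by rewrite divff ?mul1r// gt_eqF// expR_gt0.
Qed.

Lemma hwgt_dil s z : hwgt (dil (dilexp m k g) s z) = expR ((al - 2) * s) * hwgt z.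
Proof.
rewrite /hwgt slope_dil gauge_dil// powR_expRM ?gauge_ge0// exprMn invfM.
rewrite mulrBl expRD expRN expRM_natl [al * s]mulrC; ring.
Qed.

Lemma hwgt_neq0 z : hwgt z != 0 -> 0 < gauge g z.
Proof.
move=> Wz; rewrite lt_neqAle gauge_ge0 andbT; apply: contra Wz.
by rewrite /hwgt => /eqP <-; rewrite expr0n invr0 mulr0.
Qed.

(* The radial component of [grad_gamma f] is [slope * E f / gauge]. *)
Lemma hwgt_euler_le (f : 'rV[R]_(m + k) -> R) z : 0 < sqx z ->
  hwgt z * euler (dilexp m k g) f z ^+ 2 <= wgt z * grad_gamma_norm g f z ^+ 2.
Proof.
move=> N0; have r0 := gauge_gt0 g z N0.
have A0 : 0 < enorm (xpart z) by rewrite enorm_xpart powR_gt0.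
have s0 : 0 < slope z by apply: divr_gt0; exact: powR_gt0.
have := euler_grad_gamma g f z N0; rewrite (gaugeS_gauge g z g0 N0) => CS.
rewrite wgtE// /hwgt powRD ?(gt_eqF s0) ?implybT// -!mulrA !ler_wpM2l ?powR_ge0//.
rewrite (powR_mulrn 2 (ltW s0)).
have rg0 : 0 < gauge g z `^ g by rewrite powR_gt0.
have -> : slope z ^+ 2 * ((gauge g z ^+ 2)^-1 * euler (dilexp m k g) f z ^+ 2) =
  (enorm (xpart z) `^ g * euler (dilexp m k g) f z) ^+ 2 / (gauge g z ^+ 2 * (gauge g z `^ g) ^+ 2).
  by rewrite /slope; field; rewrite (gt_eqF r0) (gt_eqF rg0).
by rewrite ler_pdivrMr 1?[leRHS]mulrC//; apply: mulr_gt0; exact: exprn_gt0.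
Qed.

End weights.

(* Equals [wgt * |grad_gamma f|^2] off {x = 0}; the maximum makes it dominate the radial part everywhere. *)
Definition energy {R : realType} {m k} (g al t : R) (f : 'rV[R]_(m + k) -> R) z : R :=
  Num.max (wgt g al t z * grad_gamma_norm g f z ^+ 2) (hwgt g al t z * euler (dilexp m k g) f z ^+ 2).

(** * The Hardy identity and its weighted companion for the gauge weights *)

Section core.
Context {R : realType} {m k : nat} (g al t : R).
Hypothesis g0 : 0 < g.
Context (mu : {measure set (Rn R (m + k)) -> \bar R}) (Om : set 'rV[R]_(m + k)).
Hypothesis Hmu : lebesgue_Rn mu.
Hypothesis bOm : bounded_set Om.
Let c := @dilexp R m k g.
Let Q := homdim m k g.
Let W := @hwgt R m k g al t.
Let s : R := (Q + al - 2) / 2.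

(** The gauge grows like e^s along an orbit and is bounded by some B on [Om], so the orbit has left
    [Om] for good after time ln (B / gauge z). *)
Lemma orbit_exits (f : 'rV[R]_(m + k) -> R) z : test_fun Om f -> 0 < gauge g z ->
  exists2 M, 0 < M & forall s, M <= s -> f (dil c s z) = 0 /\ euler c f (dil c s z) = 0.
Proof.
move=> tf r0; have [B B0 HB] := gauge_bounded g g0 Om bOm.
exists (`|ln (B / gauge g z)| + 1) => [|u Mu]; first by rewrite ltr_wpDl.
suff Os : ~ Om (dil c u z) by split; [case: (test_fun_out _ _ tf _ Os)|exact: euler_out tf _ _ Os].
move=> /HB; rewrite gauge_dil// -ler_pdivlMr// => h.
have : expR (ln (B / gauge g z)) < expR u.
  by rewrite ltr_expR (le_lt_trans (ler_norm _))// (lt_le_trans _ Mu)// ltrDl.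
by rewrite lnK ?posrE ?divr_gt0// ltNge h.
Qed.

Lemma radial_hardy_identity (f : 'rV[R]_(m + k) -> R) :
  test_fun Om f -> 0 < Q + al - 2 ->
  ((s ^+ 2)%:E * \int[mu]_z (W z * f z ^+ 2)%:E
   + \int[mu]_z (W z * (euler c f z + s * f z) ^+ 2)%:E
   = \int[mu]_z (W z * euler c f z ^+ 2)%:E)%E.
Proof.
move=> tf Q0; have s0 : 0 < s by rewrite divr_gt0.
(* Since Q + al - 2 = 2 s, an exponent a gives k = 1/(2 s - a), and after division by k the
   coefficient a (2 s - a) of int W f^2. It is largest at a = s, where it equals s^2. *)
have Qs : \sum_i c i + (al - 2) - (s + 2 * 0) = s.
  by rewrite sum_dilexp -/Q /s; field.
have := @hardy_identity R _ mu c f W (al - 2) s 0 Hmu (measurable_hwgt _ _ _)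
  (hwgt_ge0 _ _ _) (hwgt_dil _ _ _ g0) (test_fun_differentiable _ _ tf)
  (test_fun_continuous_euler _ _ tf c)
  (fun z Wz => orbit_exits f z tf (hwgt_neq0 _ _ _ _ Wz)) (ltW s0).
rewrite Qs => /(_ s0) /=.
under [in RHS]eq_integral do rewrite mul0r addr0.
rewrite addr0 => H.
have I0 (F : Rn R (m + k) -> R) : (0 <= \int[mu]_z (W z * F z ^+ 2)%:E)%E.
  by apply: integral_ge0 => z _; rewrite lee_fin mulr_ge0 ?sqr_ge0 ?hwgt_ge0.
have sK x : (s%:E * ((s^-1)%:E * x) = x)%E.
  by rewrite muleA -EFinM mulfV ?gt_eqF// mul1e.
move/(congr1 (fun x => s%:E * x)%E) : H; rewrite sK => <-.
have A0 : (0 <= s%:E * \int[mu]_z (W z * f z ^+ 2)%:E)%E.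
  by rewrite mule_ge0// lee_fin ltW.
have B0 : (0 <= (s^-1)%:E * \int[mu]_z (W z * (euler c f z + s * f z) ^+ 2)%:E)%E.
  by rewrite mule_ge0// lee_fin invr_ge0 ltW.
rewrite (ge0_muleDr _ A0 B0).
by rewrite sK muleA -EFinM expr2.
Qed.

Lemma weighted_radial_hardy (f : 'rV[R]_(m + k) -> R) (e : R) : test_fun Om f -> 0 < e ->
  (\int[mu]_z (W z * gauge g z `^ e * f z ^+ 2)%:E <=
   (((e / 2) ^+ 2)^-1)%:E *
   \int[mu]_z (W z * gauge g z `^ e * (euler c f z + s * f z) ^+ 2)%:E)%E.
Proof.
move=> tf e0; have e20 : 0 < e / 2 by rewrite divr_gt0.
pose V z := W z * gauge g z `^ e.
have V0 z : 0 <= V z by rewrite mulr_ge0 ?powR_ge0 ?hwgt_ge0.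
have mV : measurable_fun [set: Rn R (m + k)] V.
  apply: measurable_funM; first exact: measurable_hwgt.
  by apply: measurable_fun_powR; exact: measurable_gauge.
have Vdil u z : V (dil c u z) = expR ((al - 2 + e) * u) * V z.
  rewrite /V /W hwgt_dil// gauge_dil// powR_expRM ?gauge_ge0//.
  by rewrite [(al - 2 + e) * u]mulrDl expRD [e * u]mulrC; ring.
have VM z : V z != 0 -> exists2 M, 0 < M & forall s, M <= s ->
    f (dil c s z) = 0 /\ euler c f (dil c s z) = 0.
  move=> Vz; apply: (orbit_exits f z tf); apply: (hwgt_neq0 g al t).
  by apply: contra Vz => /eqP; rewrite /V /W => ->; rewrite mul0r.
(* The weight now has total degree 2 s + e. Taking b = s cancels 2 s, and a (e - a) is largest at a
   = e/2, whence the constant (e/2)^2. *)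
have Qs : \sum_i c i + (al - 2 + e) - (e / 2 + 2 * s) = e / 2.
  by rewrite sum_dilexp -/Q /s; field.
have := @hardy_identity R _ mu c f V (al - 2 + e) (e / 2) s Hmu mV V0 Vdil
  (test_fun_differentiable _ _ tf) (test_fun_continuous_euler _ _ tf c) VM (ltW e20).
rewrite Qs => /(_ e20) /= H.
have I0 (F : Rn R (m + k) -> R) : (0 <= \int[mu]_z (V z * F z ^+ 2)%:E)%E.
  by apply: integral_ge0 => z _; rewrite lee_fin mulr_ge0 ?sqr_ge0.
(* The other square, with E f + (e/2 + s) f, is nonnegative and is dropped. *)
have H' : ((e / 2)%:E * \int[mu]_z (V z * f z ^+ 2)%:E <=
    ((e / 2)^-1)%:E * \int[mu]_z (V z * (euler c f z + s * f z) ^+ 2)%:E)%E.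
  by rewrite -H leeDl// mule_ge0// lee_fin invr_ge0 ltW.
have eK x : (((e / 2)^-1)%:E * ((e / 2)%:E * x) = x)%E.
  by rewrite muleA -EFinM mulVf ?gt_eqF// mul1e.
have e2i : (0 <= ((e / 2)^-1)%:E)%E by rewrite lee_fin invr_ge0 ltW.
rewrite -[leLHS](eK (\int[mu]_z (V z * f z ^+ 2)%:E)%E).
apply: (le_trans (lee_wpmul2l e2i H')).
by rewrite muleA -EFinM -invfM -expr2.
Qed.

End core.

(** * The remainder term *)

Section energy.
Context {R : realType} {m k : nat} (g al t : R) (Om : set 'rV[R]_(m + k)).
Context (f : 'rV[R]_(m + k) -> R).
Hypothesis tf : test_fun Om f.

Lemma energy_ge0 z : 0 <= energy g al t f z.
Proof. by rewrite le_max mulr_ge0 ?sqr_ge0 ?wgt_ge0. Qed.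

Lemma energy_out z : ~ Om z -> energy g al t f z = 0.
Proof.
move=> Oz; rewrite /energy (grad_gamma_norm_out g Om f z tf Oz) (euler_out Om f tf _ z Oz).
by rewrite expr0n /= !mulr0 maxxx.
Qed.

Lemma energy_neq0 z : energy g al t f z != 0 -> 0 < gauge g z.
Proof.
rewrite lt_neqAle gauge_ge0 andbT; apply: contra => /eqP r0.
by rewrite /energy /wgt /hwgt -r0 expr0n !invr0 !mulr0 !mul0r maxxx.
Qed.

Lemma measurable_energy : measurable_fun [set: Rn R (m + k)] (energy g al t f).
Proof.
apply: measurable_maxr; apply: measurable_funM.
- exact: measurable_wgt.
- by apply: measurable_funX; exact: measurable_grad_gamma_norm tf.
- exact: measurable_hwgt.
- by apply: measurable_funX; exact: measurable_euler tf _.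
Qed.

Lemma energyE z : 0 < g -> 0 < sqx z ->
  energy g al t f z = wgt g al t z * grad_gamma_norm g f z ^+ 2.
Proof. by move=> g0 N0; apply/max_idPl; exact: hwgt_euler_le. Qed.

End energy.

(** The inequality in its closed-form, whole-space version, with h = q/2. The factor gauge^e turns
    the Hardy deficit into a bound on the full weighted energy, which Hoelder converts into the
    power h. *)
Lemma energy_remainder {R : realType} {m k : nat} (g al t h : R)
    (mu : {measure set (Rn R (m + k)) -> \bar R}) (Om : set 'rV[R]_(m + k)) :
  0 < g -> lebesgue_Rn mu -> bounded_set Om -> open Om -> 0 < h < 1 ->
  0 < homdim m k g -> 0 < homdim m k g + al - 2 ->
  exists2 C : R, 0 < C & forall f, test_fun Om f ->
    ((((homdim m k g + al - 2) / 2) ^+ 2)%:E * \int[mu]_z (hwgt g al t z * f z ^+ 2)%:E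
     + C%:E * (\int[mu]_z (energy g al t f z `^ h)%:E) `^ (h^-1)
     <= \int[mu]_z (energy g al t f z)%:E)%E.
Proof.
move=> g0 Hmu bOm oOm /andP[h0 h1] Q0 Qal0.
set Q := homdim m k g in Q0 Qal0 *; set s := (Q + al - 2) / 2.
have h1' : 0 < 1 - h by rewrite subr_gt0.
pose c := @dilexp R m k g; pose W := @hwgt R m k g al t.
have [M M0 OM] := gauge_bounded g g0 Om bOm.
have mOm : measurable (Om : set (Rn R (m + k))) by exact: sub_sigma_algebra.
(* Any p strictly between 0 and Q would do. Then e is fixed by e h / (1 - h) = p, which makes the
   second Hoelder factor the integral of gauge^(-p). *)
pose p := Q / 2; pose e := p * (1 - h) / h.
have p0 : 0 < p by rewrite divr_gt0.
have e0 : 0 < e by rewrite divr_gt0// mulr_gt0.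
have pQ : 0 < p < Q by rewrite p0 /p; lra.
pose J := (\int[mu]_(z in (Om : set (Rn R (m + k)))) (gauge g z `^ (- p))%:E)%E.
have Jfin : J \is a fin_num.
  rewrite ge0_fin_numE; last by apply: integral_ge0 => z _; rewrite lee_fin powR_ge0.
  exact: integral_gauge_powR g0 mu Om M p Hmu mOm M0 OM pQ.
pose j := fine J `^ ((1 - h) / h).
have j0 : 0 <= j by exact: powR_ge0.
pose L := (((e / 2) ^+ 2)^-1); have L0 : 0 <= L by rewrite invr_ge0 sqr_ge0.
pose Me := M `^ e; have Me0 : 0 <= Me by exact: powR_ge0.
(* The sum of the constants in the bound [Xv], once [Ivf] has replaced the integral of the [f] term
   by L Me times that of W G^2. *)
pose K := Me * (2 + 2 * s ^+ 2 * L).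
have K0 : 0 <= K by rewrite mulr_ge0// addr_ge0// mulr_ge0// mulr_ge0// sqr_ge0.
have Kj : 0 < K * j + 1 by rewrite ltr_wpDl// mulr_ge0.
(* The added 1 keeps the denominator positive when [j] is 0. *)
exists (K * j + 1)^-1 => [|f tf]; first by rewrite invr_gt0.
pose X := energy g al t f; pose E := euler c f; pose G z := E z + s * f z.
pose T z := X z - W z * E z ^+ 2.
have W0 z : 0 <= W z by exact: hwgt_ge0.
have T0 z : 0 <= T z by rewrite subr_ge0 /X /energy le_max lexx orbT.
have X0 z : 0 <= X z by exact: energy_ge0.
have mW : measurable_fun [set: Rn R (m + k)] W by exact: measurable_hwgt.
have mE : measurable_fun [set: Rn R (m + k)] E by exact: measurable_euler tf _.
have mf : measurable_fun [set: Rn R (m + k)] f by exact: measurable_test_fun tf.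
have mX : measurable_fun [set: Rn R (m + k)] X by exact: measurable_energy tf.
have mG : measurable_fun [set: Rn R (m + k)] G.
  by apply: measurable_funD => //; exact: measurable_funM.
have mT : measurable_fun [set: Rn R (m + k)] T.
  by apply: measurable_funB => //; apply: measurable_funM => //; exact: measurable_funX.
have mr : measurable_fun [set: Rn R (m + k)] (fun z => gauge g z `^ e).
  by apply: measurable_fun_powR; exact: measurable_gauge.
have mWF (F : Rn R (m + k) -> R) : measurable_fun [set: Rn R (m + k)] F ->
    measurable_fun [set: Rn R (m + k)] (fun z => W z * F z ^+ 2).
  by move=> mF; apply: measurable_funM => //; exact: measurable_funX.
pose I (F : Rn R (m + k) -> R) := (\int[mu]_z (F z)%:E)%E.
have I0 (F : Rn R (m + k) -> R) : (forall z, 0 <= F z) -> (0 <= I F)%E.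
  by move=> F0; apply: integral_ge0 => z _; rewrite lee_fin.
have ID (F1 F2 : Rn R (m + k) -> R) : (forall z, 0 <= F1 z) -> (forall z, 0 <= F2 z) ->
    measurable_fun [set: Rn R (m + k)] F1 -> measurable_fun [set: Rn R (m + k)] F2 ->
    (I (fun z => (F1 z + F2 z)%R) = I F1 + I F2)%E.
  move=> F10 F20 mF1 mF2; rewrite /I -ge0_integralD//.
  - by move=> z _; rewrite lee_fin.
  - exact/measurable_EFinP.
  - by move=> z _; rewrite lee_fin.
  - exact/measurable_EFinP.
have IZ a (F : Rn R (m + k) -> R) : 0 <= a -> (forall z, 0 <= F z) -> measurable_fun [set: Rn R (m + k)] F ->
    (I (fun z => (a * F z)%R) = a%:E * I F)%E.
  move=> a0 F0 mF; rewrite /I -ge0_integralZl_EFin//.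
  - by move=> z _; rewrite lee_fin.
  - exact/measurable_EFinP.
have Ile (F1 F2 : Rn R (m + k) -> R) : (forall z, 0 <= F1 z) -> (forall z, F1 z <= F2 z) ->
    measurable_fun [set: Rn R (m + k)] F1 -> measurable_fun [set: Rn R (m + k)] F2 ->
    (I F1 <= I F2)%E.
  move=> F10 F12 mF1 mF2; apply: ge0_le_integral => //.
  - by move=> z _; rewrite lee_fin.
  - exact/measurable_EFinP.
  - exact/measurable_EFinP.
  - by move=> z _; rewrite lee_fin.
have WF0 (F : Rn R (m + k) -> R) z : 0 <= W z * F z ^+ 2 by rewrite mulr_ge0 ?sqr_ge0.
(* The Hardy deficit, written as a sum because the two integrals that it compares may both be
   +oo. *)
pose D := (I T + I (fun z => (W z * G z ^+ 2)%R))%E.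
have D0 : (0 <= D)%E by rewrite adde_ge0 ?I0.
have total : (I X = (s ^+ 2)%:E * I (fun z => (W z * f z ^+ 2)%R) + D)%E.
  rewrite /D addeCA (radial_hardy_identity g al t g0 mu Om Hmu bOm f tf Qal0).
  by rewrite -[RHS]ID//; [congr I; apply/funext => z; rewrite subrK|exact: mWF].
have vOm z : Om z -> gauge g z `^ e <= Me.
  by move=> /OM rM; apply: ge0_ler_powR; rewrite ?nnegrE ?gauge_ge0//; exact: ltW.
have fOm z : ~ Om z -> f z = 0 by move=> /(test_fun_out _ _ tf)[].
have EOm z : ~ Om z -> E z = 0 by exact: euler_out tf _ _.
have WvG z : W z * gauge g z `^ e * G z ^+ 2 <= Me * (W z * G z ^+ 2).
  have [/vOm zM|Oz] := pselect (Om z).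
    by rewrite mulrAC mulrC ler_wpM2r.
  by rewrite /G fOm// EOm// mulr0 addr0 expr0n /= !mulr0.
have mv (F : Rn R (m + k) -> R) : measurable_fun [set: Rn R (m + k)] F ->
    measurable_fun [set: Rn R (m + k)] (fun z => W z * gauge g z `^ e * F z ^+ 2).
  by move=> mF; apply: measurable_funM; [exact: measurable_funM|exact: measurable_funX].
have v0 (F : Rn R (m + k) -> R) z : 0 <= W z * gauge g z `^ e * F z ^+ 2.
  by rewrite mulr_ge0 ?sqr_ge0// mulr_ge0 ?powR_ge0.
have mMe (F : Rn R (m + k) -> R) (a : R) : measurable_fun [set: Rn R (m + k)] F ->
    measurable_fun [set: Rn R (m + k)] (fun z => a * F z).
  by move=> mF; exact: measurable_funM.
have Ivf : (I (fun z => (W z * gauge g z `^ e * f z ^+ 2)%R) <=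
    (L * Me)%:E * I (fun z => (W z * G z ^+ 2)%R))%E.
  apply: (le_trans (weighted_radial_hardy g al t g0 mu Om Hmu bOm f e tf e0)).
  rewrite EFinM -muleA lee_wpmul2l ?lee_fin// -(IZ Me _ Me0 (WF0 G) (mWF G mG)).
  exact: (Ile _ _ (v0 G) WvG (mv G mG) (mMe _ _ (mWF G mG))).
have Xv z : X z * gauge g z `^ e <= Me * T z + (2 * Me * (W z * G z ^+ 2)
    + 2 * s ^+ 2 * (W z * gauge g z `^ e * f z ^+ 2)).
  have [/vOm zM|Oz] := pselect (Om z); last first.
    rewrite /T /X (energy_out g al t Om f tf)// /G fOm// EOm// mul0r mulr0 addr0 expr0n /= !mulr0.
    by rewrite subrr mulr0 !addr0.
  (* Here E = G - s f, and 2 G^2 + 2 s^2 f^2 - E^2 is exactly (E + 2 s f)^2. *)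
  have E2 : E z ^+ 2 <= 2 * G z ^+ 2 + 2 * s ^+ 2 * f z ^+ 2.
    by rewrite /G; have := sqr_ge0 (E z + 2 * s * f z); nra.
  have -> : X z = T z + W z * E z ^+ 2 by rewrite /T subrK.
  have r0 := powR_ge0 (gauge g z) e.
  have a1 : T z * gauge g z `^ e <= Me * T z by rewrite mulrC ler_wpM2r.
  have a2 : W z * E z ^+ 2 * gauge g z `^ e <=
      W z * gauge g z `^ e * (2 * G z ^+ 2 + 2 * s ^+ 2 * f z ^+ 2).
    by rewrite mulrAC ler_wpM2l// mulr_ge0.
  have := WvG z; rewrite mulrDl; move: a1 a2.
  rewrite mulrDr; lra.
have IXv : (I (fun z => (X z * gauge g z `^ e)%R) <= K%:E * D)%E.
  have m1 : measurable_fun [set: Rn R (m + k)] (fun z => Me * T z) by exact: mMe.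
  have m2 : measurable_fun [set: Rn R (m + k)] (fun z => 2 * Me * (W z * G z ^+ 2)).
    by apply: mMe; exact: mWF.
  have m3 : measurable_fun [set: Rn R (m + k)] (fun z => 2 * s ^+ 2 * (W z * gauge g z `^ e * f z ^+ 2)).
    by apply: mMe; exact: (mv f).
  have s2 := sqr_ge0 s.
  have p1 z : 0 <= Me * T z by rewrite mulr_ge0.
  have p2 z : 0 <= 2 * Me * (W z * G z ^+ 2) by rewrite mulr_ge0// mulr_ge0.
  have p3 z : 0 <= 2 * s ^+ 2 * (W z * gauge g z `^ e * f z ^+ 2).
    by rewrite mulr_ge0// mulr_ge0.
  have p23 z : 0 <= 2 * Me * (W z * G z ^+ 2) + 2 * s ^+ 2 * (W z * gauge g z `^ e * f z ^+ 2).
    exact: addr_ge0.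
  have m23 := measurable_funD m2 m3.
  apply: (@le_trans _ _ (I (fun z => (Me * T z + (2 * Me * (W z * G z ^+ 2)
      + 2 * s ^+ 2 * (W z * gauge g z `^ e * f z ^+ 2)))%R))).
    apply: Ile => //; first by move=> z; rewrite mulr_ge0 ?powR_ge0.
      exact: measurable_funM.
    exact: measurable_funD.
  have Me2 : 0 <= 2 * Me by rewrite mulr_ge0.
  have s22 : 0 <= 2 * s ^+ 2 by rewrite mulr_ge0.
  rewrite (ID _ _ p1 p23 m1 m23) (ID _ _ p2 p3 m2 m3) (IZ _ _ Me0 T0 mT).
  rewrite (IZ _ _ Me2 (WF0 G) (mWF G mG)) (IZ _ _ s22 (v0 f) (mv f mf)).
  have IT0 := I0 _ T0; have IG0 := I0 _ (WF0 G).
  rewrite /D (ge0_muleDr _ IT0 IG0); apply: leeD.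
    rewrite lee_wpmul2r// lee_fin /K ler_peMr//.
    by have := mulr_ge0 s2 L0; lra.
  apply: (@le_trans _ _ ((2 * Me)%:E * I (fun z => (W z * G z ^+ 2)%R)
      + (2 * s ^+ 2)%:E * ((L * Me)%:E * I (fun z => (W z * G z ^+ 2)%R)))%E).
    by rewrite leeD2l// lee_wpmul2l// lee_fin mulr_ge0.
  have c1 : (0 <= (2 * Me)%:E)%E by rewrite lee_fin.
  have c2 : (0 <= (2 * s ^+ 2 * (L * Me))%:E)%E by rewrite lee_fin (mulr_ge0 s22)// mulr_ge0.
  rewrite muleA -EFinM -(ge0_muleDl _ c1 c2) -EFinD.
  by rewrite (_ : 2 * Me + 2 * s ^+ 2 * (L * Me) = K)// /K; ring.
have hw : ((I (fun z => (X z `^ h)%R)) `^ (h^-1) <= (K * j)%:E * D)%E.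
  have XD z : X z != 0 -> Om z /\ 0 < gauge g z `^ e.
    move=> Xz; split; last by apply: powR_gt0; exact: (energy_neq0 g al t f z Xz).
    by apply: contrapT => /(energy_out g al t Om f tf) X0z; rewrite /X X0z eqxx in Xz.
  have h01 : 0 < h < 1 by rewrite h0.
  apply: (le_trans (@hoelder_weight _ (Rn R (m + k)) R mu Om X (fun z => gauge g z `^ e) h
    h01 mOm mX mr X0 (fun z => powR_ge0 _ _) XD)).
  rewrite [X in (_ * X `^ _)%E](_ : _ = J); last first.
    apply: eq_integral => z _; rewrite -powRrM; congr (_ `^ _)%:E.
    by rewrite /e; field; rewrite !gt_eqF.
  rewrite -(fineK Jfin) poweR_EFin -/j muleC EFinM -[leRHS]muleA [leRHS]muleCA.
  by rewrite lee_wpmul2l// lee_fin.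
rewrite -[leRHS]/(I X) total; apply: leeD2l.
apply: (@le_trans _ _ (((K * j + 1)^-1)%:E * ((K * j + 1)%:E * D))%E).
  apply: lee_wpmul2l; first by rewrite lee_fin invr_ge0 ltW.
  by apply: (le_trans hw); rewrite lee_wpmul2r// lee_fin lerDl.
by rewrite muleA -EFinM mulVf ?gt_eqF// mul1e.
Qed.

(** * Return to the integrands of the statement *)

Lemma powR_mul_sqr {R : realType} (w x p : R) : 0 <= w -> 0 <= x ->
  (w * x ^+ 2) `^ (p / 2) = x `^ p * w `^ (p / 2).
Proof.
move=> w0 x0; rewrite powRM ?sqr_ge0// mulrC -(powR_mulrn 2 x0) -powRrM.
by congr (_ `^ _ * _); field.
Qed.

Lemma integral_vanishing_out {d} {T : measurableType d} {R : realType}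
    (mu : {measure set T -> \bar R}) (D : set T) (F : T -> R) :
  (forall z, ~ D z -> F z = 0) ->
  (\int[mu]_(z in D) (F z)%:E = \int[mu]_z (F z)%:E)%E.
Proof.
move=> F0; rewrite integral_mkcond; apply: eq_integral => z _.
by rewrite patchE; case: ifPn => //; rewrite notin_setE => /F0 ->.
Qed.

Theorem theorem3p4 (R : realType) (m k : nat) (g : R)
  (mu : {measure set (Rn R (m + k)) -> \bar R})
  (Om : set 'rV[R]_(m + k)) (q al t : R) :
  (0 < m)%N -> (0 < k)%N -> 0 < g ->
  lebesgue_Rn mu ->
  smooth_bounded_domain Om -> Om 0 ->
  1 < q < 2 ->
  0 < homdim m k g + al - 2 ->
  exists C : R, 0 < C /\
    forall phi : 'rV[R]_(m + k) -> R, test_fun Om phi ->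
      ((((homdim m k g + al - 2) / 2) ^+ 2)%:E *
         \int[mu]_(z in Om)
           (@gauge R m k g z `^ al * grad_gamma_norm g (@gauge R m k g) z `^ (t + 2)
              / @gauge R m k g z ^+ 2 * phi z ^+ 2)%:E
       + C%:E *
         (\int[mu]_(z in Om)
            (grad_gamma_norm g phi z `^ q *
             (grad_gamma_norm g (@gauge R m k g) z `^ t * @gauge R m k g z `^ al)
               `^ (q / 2))%:E) `^ (2 / q)
      <= \int[mu]_(z in Om)
           (@gauge R m k g z `^ al * grad_gamma_norm g (@gauge R m k g) z `^ t
              * grad_gamma_norm g phi z ^+ 2)%:E)%E.
Proof.
move=> m0 k0 g0 Hmu [oOm [_ [bOm _]]] _ /andP[q1 q2] Qal.
have q0 : 0 < q by exact: lt_trans q1.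
have h01 : 0 < q / 2 < 1 by apply/andP; split; lra.
have Q0 : 0 < homdim m k g.
  by rewrite ltr_pwDl ?ltr0n// mulr_ge0// addr_ge0// ltW.
have [C C0 HC] := energy_remainder g al t (q / 2) mu Om g0 Hmu bOm oOm h01 Q0 Qal.
exists C; split=> // phi tf; have := HC phi tf.
have mOm : measurable (Om : set (Rn R (m + k))) by exact: sub_sigma_algebra.
pose i0 := lshift k (Ordinal m0).
(* A null hyperplane containing {x = 0}, available because x has at least one coordinate. Off it the
   gauge is differentiable and its gradient norm is [slope]. *)
pose N : set (Rn R (m + k)) := [set z : Rn R (m + k) | (z : 'rV[R]_(m + k)) 0 i0 = 0].
have N0 : mu N = 0%E by exact: lebesgue_hyperplane.
have mN : measurable N.
  rewrite -[N]setTI; apply: (measurable_coord R (m + k) i0 measurableT [set 0]).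
  exact: measurable_set1.
have sqx_gt0 z : ~ N z -> 0 < sqx z.
  move=> Nz; rewrite /sqx (bigD1 (Ordinal m0))//= ltr_pwDl//.
    by rewrite lt_neqAle sqr_ge0 andbT eq_sym sqrf_eq0; apply/eqP.
  by rewrite sumr_ge0// => i _; exact: sqr_ge0.
have gradE z : ~ N z -> grad_gamma_norm g (@gauge R m k g) z = slope g z.
  by move=> /sqx_gt0 /(grad_gamma_gauge g z g0).
(* Replaces an integrand of the statement, whose gauge gradient has been computed only off {x = 0},
   by a measurable one equal to it off [N]; as the latter vanishes outside [Om], the integral
   extends to the whole space. *)
have conv (F F' : Rn R (m + k) -> R) : measurable_fun [set: Rn R (m + k)] F' ->
    (forall z, 0 <= F z) -> (forall z, 0 <= F' z) -> (forall z, ~ Om z -> F' z = 0) ->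
    (forall z, ~ N z -> F z = F' z) ->
    (\int[mu]_(z in (Om : set (Rn R (m + k)))) (F z)%:E = \int[mu]_z (F' z)%:E)%E.
  move=> mF' F0 F'0 F'out FF'.
  rewrite (ge0_integral_off_null mu N Om (fun z => (F z)%:E) (fun z => (F' z)%:E))//.
  - exact: integral_vanishing_out.
  - exact/measurable_EFinP.
  - by move=> z Nz; rewrite FF'.
have mX := measurable_energy g al t Om phi tf.
have hardyE := conv (fun z => @gauge R m k g z `^ al * grad_gamma_norm g (@gauge R m k g) z `^ (t + 2)
  / @gauge R m k g z ^+ 2 * phi z ^+ 2) (fun z => hwgt g al t z * phi z ^+ 2).
rewrite -hardyE; first last.
- by move=> z Nz; rewrite gradE.
- by move=> z /(test_fun_out _ _ tf)[-> _]; rewrite expr0n mulr0.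
- by move=> z; apply: mulr_ge0; [exact: hwgt_ge0|exact: sqr_ge0].
- move=> z; apply: mulr_ge0; last exact: sqr_ge0.
  by apply: divr_ge0; [apply: mulr_ge0; exact: powR_ge0|exact: sqr_ge0].
- apply: measurable_funM; first exact: measurable_hwgt.
  by apply: measurable_funX; exact: measurable_test_fun tf.
have energyI := conv (fun z => @gauge R m k g z `^ al * grad_gamma_norm g (@gauge R m k g) z `^ t
  * grad_gamma_norm g phi z ^+ 2) (energy g al t phi).
rewrite -energyI; first last.
- move=> z Nz; have N0z := sqx_gt0 z Nz.
  by rewrite (gradE z Nz) (energyE g al t phi z g0 N0z) (wgtE g al t z (gauge_gt0 g z N0z)).
- exact: energy_out tf.
- exact: energy_ge0.
- move=> z; apply: mulr_ge0; last exact: sqr_ge0.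
  by apply: mulr_ge0; exact: powR_ge0.
- exact: mX.
have powerE := conv (fun z => grad_gamma_norm g phi z `^ q *
  (grad_gamma_norm g (@gauge R m k g) z `^ t * @gauge R m k g z `^ al) `^ (q / 2))
  (fun z => energy g al t phi z `^ (q / 2)).
rewrite -powerE; first last.
- move=> z Nz; have N0z := sqx_gt0 z Nz.
  have r0 := gauge_gt0 g z N0z.
  rewrite (gradE z Nz) (energyE g al t phi z g0 N0z) (wgtE g al t z r0) [slope g z `^ t * _]mulrC.
  rewrite powR_mul_sqr//; first by apply: mulr_ge0; exact: powR_ge0.
  exact: sqrtr_ge0.
- move=> z Oz; rewrite (energy_out g al t Om phi tf z Oz).
  by case/andP: h01 => h0 _; apply: powR0; exact: lt0r_neq0.
- by move=> z; exact: powR_ge0.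
- by move=> z; apply: mulr_ge0; exact: powR_ge0.
- exact: measurable_fun_powR mX.
by rewrite invf_div.
Qed.
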